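(* Let $F_2\times\mathbb{Z}$ be the direct product of the free group $F_2$ on $\{x,y\}$ and the infinite cyclic group generated by $t$. For every integer $p\ge 1$, the subgroups $$\mathcal{H}_1=\langle x^3t^{6},\ yx,\ t^{6p}\rangle,\qquad \mathcal{H}_2=\langle x^2t^{4},\ yxy^{-1}\rangle$$ have ranks $3$ and $2$ respectively, and $\mathcal{H}_1\cap\mathcal{H}_2$ has rank $p+1$. Hence, in any group containing $F_2\times\mathbb{Z}$, the rank of a finitely generated intersection of two finitely generated subgroups cannot be bounded in terms of the ranks of the intersecting subgroups. Moreover, $3$ and $2$ are the minimum possible ranks for such a phenomenon in $F_2\times\mathbb{Z}$: if $a,b$ are non-negative integers with $a+b<5$, then the finite values of $\mathrm{rk}(\mathcal{K}_1\cap\mathcal{K}_2)$, for subgroups $\mathcal{K}_1,\mathcal{K}_2\leqslant F_2\times\mathbb{Z}$ with $\mathrm{rk}(\mathcal{K}_1)=a$ and $\mathrm{rk}(\mathcal{K}_2)=b$, are bounded.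
   Context: The rank $\mathrm{rk}(G)$ of a group $G$ is the minimum cardinality of a generating set of $G$. *)

(* Defs.v *)
From HB Require Import structures.
From mathcomp Require Import all_boot all_order all_algebra.
From mathcomp Require Import boolp classical_sets cardinality.

Set Implicit Arguments.
Unset Strict Implicit.
Unset Printing Implicit Defensive.

Local Open Scope group_scope.
Local Open Scope classical_set_scope.
Local Open Scope card_scope.

(* The free group on T, realized as the reduced words over the letters x      *)
(* (encoded (x, false)) and x^-1 (encoded (x, true)), for x in T. The product *)
(* is concatenation followed by free reduction.                               *)
Section FreeGroup.
Variable T : choiceType.
Implicit Types (a b : T * bool) (u v w : seq (T * bool)).

Definition inv_letter a : T * bool := (a.1, ~~ a.2).

Definition reduced w := sorted (fun a b => b != inv_letter a) w.

(* For reduced w, the reduced form of a :: w. *)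
Definition push a w :=
  if w is b :: w' then (if b == inv_letter a then w' else a :: w) else [:: a].

Definition word_mul u v := foldr push v u.
Definition word_inv u := rev (map inv_letter u).

Lemma inv_letterK : involutive inv_letter.
Proof. by case=> x e; rewrite /inv_letter /= negbK. Qed.

Lemma reduced_behead a w : reduced (a :: w) -> reduced w.
Proof. exact: path_sorted. Qed.

Lemma reduced_push a w : reduced w -> reduced (push a w).
Proof.
case: w => [//|b w] /=; case: eqVneq => [_|ne] bw; first exact: path_sorted bw.
by rewrite /reduced /= ne.
Qed.

Lemma pushK a w : reduced w -> push (inv_letter a) (push a w) = w.
Proof.
case: w => [_|b w] /=; first by rewrite inv_letterK eqxx.
case: eqVneq => [-> |_ _]; last by rewrite /= inv_letterK eqxx.
by case: w => [//|c w] /= /andP[/negPf-> _].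
Qed.

Lemma pushVK a w : reduced w -> push a (push (inv_letter a) w) = w.
Proof. by move=> /(pushK (inv_letter a)); rewrite inv_letterK. Qed.

Lemma reduced_mul u v : reduced v -> reduced (word_mul u v).
Proof. by move=> rv; elim: u => [//|a u IHu] /=; apply: reduced_push. Qed.

Lemma word_mul_push a u v :
  reduced v -> word_mul (push a u) v = push a (word_mul u v).
Proof.
case: u => [//|b u] rv /=; case: eqVneq => [->|//].
by rewrite pushVK // reduced_mul.
Qed.

Lemma word_mulA u v w :
  reduced w -> word_mul u (word_mul v w) = word_mul (word_mul u v) w.
Proof.
move=> rw; elim: u => [//|a u IHu] /=.
by rewrite word_mul_push // IHu.
Qed.

Lemma word_mul0 u : reduced u -> word_mul u [::] = u.
Proof.
elim: u => [//|a u IHu] /= au; rewrite IHu ?(reduced_behead au) //.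
by case: u au {IHu} => [//|b u] /= /andP[/negPf-> _].
Qed.

Lemma reduced_inv u : reduced u -> reduced (word_inv u).
Proof.
rewrite /reduced /word_inv rev_sorted sorted_map; apply: sub_sorted => a b /=.
by rewrite inv_letterK eq_sym.
Qed.

Lemma word_invK : involutive word_inv.
Proof.
by move=> u; rewrite /word_inv map_rev revK -map_comp map_id_in // => a _;
  apply: inv_letterK.
Qed.

Lemma word_mulV u : word_mul (word_inv u) u = [::].
Proof.
rewrite /word_mul /word_inv; elim: u => [//|a u IHu] /=.
by rewrite rev_cons foldr_rcons /= inv_letterK eqxx.
Qed.

Record free_group := FreeWord {
  fg_word :> seq (T * bool);
  fg_reduced : reduced fg_word
}.

HB.instance Definition _ := [isSub for fg_word].
HB.instance Definition _ := [Choice of free_group by <:].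

Definition fg_one := @FreeWord [::] isT.
Definition fg_mul (u v : free_group) := FreeWord (reduced_mul u (fg_reduced v)).
Definition fg_inv (u : free_group) := FreeWord (reduced_inv (fg_reduced u)).
Definition fg_gen (x : T) := @FreeWord [:: (x, false)] isT.

Fact fg_mulA : associative fg_mul.
Proof. by move=> u v w; apply: val_inj; apply: word_mulA; apply: valP. Qed.
Fact fg_mul1 : left_id fg_one fg_mul.
Proof. by move=> u; apply: val_inj. Qed.
Fact fg_mulr1 : right_id fg_one fg_mul.
Proof. by move=> u; apply: val_inj; apply: word_mul0; apply: valP. Qed.
Fact fg_mulV : left_inverse fg_one fg_inv fg_mul.
Proof. by move=> u; apply: val_inj; apply: word_mulV. Qed.
Fact fg_mulrV : right_inverse fg_one fg_inv fg_mul.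
Proof.
move=> u; apply: val_inj => /=.
by rewrite -{1}(word_invK u); apply: word_mulV.
Qed.

HB.instance Definition _ :=
  isGroup.Build free_group fg_mulA fg_mul1 fg_mulr1 fg_mulV fg_mulrV.

End FreeGroup.

Section Rank.
Variable G : groupType.
Implicit Types (H S : set G).

Definition is_subgroup H :=
  [/\ H 1, forall x y, H x -> H y -> H (x * y) & forall x, H x -> H x^-1].

Definition generated S : set G := smallest is_subgroup S.

(* rk(H) = n, for a natural number n. In particular H is finitely generated   *)
(* if and only if has_rank H n holds for some n.                              *)
Definition has_rank H (n : nat) :=
  (exists S, generated S = H /\ S #= `I_n) /\
  (forall S, generated S = H -> `I_n #<= S).

End Rank.

Definition F2 : groupType := free_group bool.

(* The infinite cyclic factor is the additive group of int, read              *)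
(* multiplicatively.                                                          *)
Definition F2xZ : groupType := (F2 * Algebra.to_multiplicative int)%type.

Definition x : F2xZ := (fg_gen false, 1).
Definition y : F2xZ := (fg_gen true, 1).
Definition t : F2xZ := (1, 1%R : int).

(* Main.v *)
Require Import Defs.
From mathcomp Require Import all_boot all_order all_algebra.
From mathcomp Require Import boolp classical_sets cardinality.
From mathcomp Require Import zify ring.

Set Implicit Arguments.
Unset Strict Implicit.
Unset Printing Implicit Defensive.

Import Order.TTheory GRing.Theory Num.Theory.

Local Open Scope group_scope.
Local Open Scope classical_set_scope.
Local Open Scope card_scope.

(** The explicit subgroups. Write [U := x ^+ 6 * t ^+ 12] and
    [V := y * x ^+ 3 * y^-1]. The Stallings graphs of the projections of the two
    subgroups to [F2] are small, and their product shows that these projections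
    meet in the free group on [x ^+ 6] and [V]. A word in these two elements lifts
    to both subgroups; the two lifts of [x ^+ 6] agree, whereas those of [V] differ
    by [t ^+ 6], and the first subgroup knows the exponent of [t] modulo [6 * p]
    only. So the lifts agree when the exponent sum of [V] is divisible by [p]
    ([intersectionE]), which describes a subgroup of index [p] in a free group of
    rank 2. Its [p + 1] Schreier generators are independent in its abelianization
    ([K_rank]), where independence bounds the size of any generating set from below
    ([leq_independent]). Since injective homomorphisms preserve ranks and
    intersections, no bound exists in a group containing [F2xZ].

    The case of small ranks. If one of the subgroups is cyclic, so is the
    intersection; there remain two subgroups of rank 2. Let a subgroup of a free
    group act on the Cayley tree. The quotient is the Schreier graph; choose a
    geodesic spanning tree in it. The edges outside of this tree give free
    generators of the subgroup: they generate it ([schreier_generated]), and the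
    numbers of times that a word crosses each of them are coordinates on its
    abelianization ([crossing_schreier_gen]). This has three consequences.

    - A subgroup generated by two elements and meeting the centre [<t>] has a
      projection with at most one such edge, thus a cyclic projection
      ([rank2_dichotomy]); then the intersection is generated by two elements.
    - The part of the Schreier graph met by reduced closed paths has few branch
      vertices when there are few edges outside of the spanning tree, and
      conversely ([branch_card], [leaf_card_branch]). For the intersection of two
      subgroups, a branch vertex other than the root is determined by its images,
      which are branch vertices for the two subgroups ([branchI_card]). This bounds the rank of the
      intersection of two subgroups of a free group in terms of their ranks.
    - An element that normalizes a nontrivial finitely generated subgroup of a free
      group has a positive power in it ([normalized_finite_leaf_trivial]).

    When both subgroups of rank 2 project injectively, their intersection projects
    onto the kernel of the homomorphism to the integers that compares the two lifts of an
    element of the intersection of the projections. If this homomorphism is zero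
    the second fact bounds the rank; otherwise, by the third one, the kernel is
    trivial as soon as it is finitely generated ([rank2_injective]). *)

(** * Rank and generating sets *)

Section Counting.

Lemma card_le_inj (A B : Type) (P : set A) (Q : set B) (f : A -> B) :
  (forall a, P a -> Q (f a)) ->
  (forall a b, P a -> P b -> f a = f b -> a = b) -> P #<= Q.
Proof.
elim/Ppointed: B => B in Q f *.
  move=> PQ _; suff -> : P = set0 by exact: card_ge0.
  by apply/seteqP; split=> // a; have := no (f a).
move=> PQ finj; apply/pcard_leP/injfunPex; exists f => // a b.
by rewrite !inE; apply: finj.
Qed.

Lemma card_le_mem (E : eqType) (S : set E) (s : seq E) :
  S `<=` [set` s] -> S #<= `I_(size s).
Proof.
move=> Ss; apply: (@card_le_inj _ _ _ _ (index^~ s)) => [e /Ss|e e' /Ss es /Ss e's].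
  by rewrite /= -index_mem.
exact: index_inj.
Qed.

Lemma card_ge_uniq (E : eqType) (S : set E) (s : seq E) :
  uniq s -> [set` s] `<=` S -> `I_(size s) #<= S.
Proof.
case: s => [|e0 s] us sS.
  by rewrite (_ : `I_0 = set0) //; apply/seteqP; split=> // k; rewrite /= ltn0.
apply: (@card_le_inj _ _ _ _ (nth e0 (e0 :: s))) => [k ks|k l ks ls /eqP].
  exact/sS/mem_nth.
by rewrite nth_uniq // => /eqP.
Qed.

Lemma card_le_seqP (E : choiceType) (S : set E) n :
  S #<= `I_n -> exists2 s : seq E, (size s <= n)%N & S = [set` s].
Proof.
move=> Sn; have /finite_seqP[s0 Ss0] : finite_set S by apply/finite_set_leP; exists n.
have Ss : S = [set` undup s0].
  by rewrite Ss0; apply/seteqP; split=> e /=; rewrite mem_undup.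
exists (undup s0) => //; rewrite -card_le_II; apply: card_le_trans Sn.
by apply: card_ge_uniq; [exact: undup_uniq|rewrite Ss].
Qed.

Lemma card_le_bound (E : choiceType) (S : set E) n :
  (forall s : seq E, uniq s -> [set` s] `<=` S -> (size s <= n)%N) -> S #<= `I_n.
Proof.
move=> bound; have [/finite_seqP[s Ss]|/(infinite_set_fset n.+1)[B BS nB]] :=
    pselect (finite_set S).
  have Ss' : S = [set` undup s].
    by rewrite Ss; apply/seteqP; split=> e /=; rewrite mem_undup.
  apply: (@card_le_trans _ _ _ `I_(size (undup s))).
    by apply: card_le_mem; rewrite -Ss'.
  by rewrite card_le_II bound ?undup_uniq // -Ss'.
by have := leq_trans nB (bound _ (finmap.fset_uniq B) BS); rewrite ltnn.
Qed.

End Counting.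

Section SubgroupTheory.
Variable G : groupType.
Implicit Types (H K S : set G) (g h : G).

Lemma generated_subgroup S : is_subgroup (generated S).
Proof.
split=> [K [[]]//|g h gS hS K KS|g gS K KS].
- by have [[_ KM _] _] := KS; apply: KM; [apply: gS|apply: hS].
- by have [[_ _ KV] _] := KS; apply: KV; apply: gS.
Qed.

Lemma generated_sub S K : is_subgroup K -> S `<=` K -> generated S `<=` K.
Proof. exact: smallest_sub. Qed.

Lemma mem_generated S : S `<=` generated S.
Proof. exact: sub_gen_smallest. Qed.

Lemma generatedP S K :
  is_subgroup K -> S `<=` K -> K `<=` generated S -> generated S = K.
Proof. by move=> Kg SK KS; apply/seteqP; split=> //; apply: generated_sub. Qed.

Lemma subgroupI H K : is_subgroup H -> is_subgroup K -> is_subgroup (H `&` K).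
Proof.
move=> [H1 HM HV] [K1 KM KV]; split=> //.
- by move=> g h [Hg Kg] [Hh Kh]; split; [apply: HM|apply: KM].
- by move=> g [Hg Kg]; split; [apply: HV|apply: KV].
Qed.

Section Membership.
Variable K : set G.
Hypothesis Kg : is_subgroup K.

Lemma sub1g : K 1. Proof. by case: Kg. Qed.

Lemma subMg g h : K g -> K h -> K (g * h). Proof. by case: Kg => _ KM _; apply: KM. Qed.

Lemma subVg g : K g -> K g^-1. Proof. by case: Kg => _ _ KV; apply: KV. Qed.

Lemma subXg g n : K g -> K (g ^+ n).
Proof.
by move=> Kx; elim: n => [|n IHn]; [exact: sub1g|rewrite expgS; apply: subMg].
Qed.

Lemma subMgr g h : K h -> K (g * h) -> K g.
Proof. by move=> Kx Kxy; rewrite -(mulgK h g); apply: subMg => //; apply: subVg. Qed.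

End Membership.

Lemma has_rank_gens K r :
  has_rank K r -> exists2 S, generated S = K & S #<= `I_r.
Proof.
by move=> [[S [SK Sr]] _]; exists S => //; move: Sr; rewrite card_eq_le => /andP[].
Qed.

Lemma has_rank_leq K S r n :
  has_rank K r -> generated S = K -> S #<= `I_n -> (r <= n)%N.
Proof.
move=> [_ /(_ S) rS] SK Sn; rewrite -card_le_II; apply: card_le_trans Sn.
exact: rS.
Qed.

(** The images under [phi] of the generators span the images of all of [K], and
    a triangular matrix with nonzero diagonal has full rank. *)
Lemma leq_independent K S n k (g : 'I_k -> G) (phi : 'I_k -> G -> int) :
  generated S = K -> S #<= `I_n ->
  (forall i a b, K a -> K b -> phi i (a * b) = (phi i a + phi i b)%R) ->
  (forall i, K (g i)) ->
  (forall i j : 'I_k, (j < i)%N -> phi j (g i) = 0%R) ->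
  (forall i, phi i (g i) <> 0%R) ->
  (k <= n)%N.
Proof.
move=> SK Sn phiM Kgi phi0 phiN.
have Kg : is_subgroup K by rewrite -SK; apply: generated_subgroup.
have [e ltes Se] := card_le_seqP Sn.
have SsubK : S `<=` K by rewrite -SK; apply: mem_generated.
have phi1 i : phi i 1 = 0%R.
  by have := phiM i 1 1 (sub1g Kg) (sub1g Kg); rewrite mulg1; lia.
have phiV i a : K a -> phi i a^-1 = (- phi i a)%R.
  by move=> Ka; have := phiM i _ _ Ka (subVg Kg Ka); rewrite mulgV phi1; lia.
pose row a : 'rV[rat]_k := (\row_i (phi i a)%:~R)%R.
pose M : 'M[rat]_(n, k) := (\matrix_(i < n) row (nth 1%g e i))%R.
have rowM : forall a, K a -> (row a <= M)%MS.
  suff : K `<=` [set a | K a /\ (row a <= M)%MS] by move=> sub a /sub[].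
  rewrite -{1}SK; apply: generated_sub; first split.
  - split; first exact: sub1g.
    by rewrite (_ : row 1 = 0%R) ?sub0mx //; apply/rowP => i; rewrite !mxE phi1.
  - move=> a b [Ka Ma] [Kb Mb]; split; first exact: subMg.
    rewrite (_ : row (a * b) = (row a + row b)%R) ?addmx_sub //.
    by apply/rowP => i; rewrite !mxE phiM // rmorphD.
  - move=> a [Ka Ma]; split; first exact: subVg.
    rewrite (_ : row a^-1 = (- row a)%R) ?eqmx_opp //.
    by apply/rowP => i; rewrite !mxE phiV // rmorphN.
  move=> s Ss; split; first exact: SsubK.
  have lt_sn : (index s e < n)%N.
    by apply: leq_trans ltes; rewrite index_mem; move: Ss; rewrite Se.
  have := row_sub (Ordinal lt_sn) M; rewrite rowK /= nth_index //.
  by move: Ss; rewrite Se.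
pose D : 'M[rat]_k := (\matrix_(i < k) row (g i))%R.
have DM : (D <= M)%MS by apply/row_subP => i; rewrite rowK; apply: rowM.
have Dunit : D \in unitmx.
  have Dtrig : is_trig_mx D^T.
    by apply/is_trig_mxP => i j lt_ij; rewrite !mxE phi0.
  rewrite -unitmx_tr unitmxE unitfE det_trig //; apply/prodf_neq0 => i _.
  by rewrite !mxE intr_eq0; apply/eqP.
rewrite -(mxrank_unit Dunit); apply: leq_trans (mxrankS DM) _.
exact: rank_leq_row.
Qed.

Lemma has_rank_intro K S n (g : 'I_n -> G) (phi : 'I_n -> G -> int) :
  generated S = K -> S #<= `I_n ->
  (forall i a b, K a -> K b -> phi i (a * b) = (phi i a + phi i b)%R) ->
  (forall i, K (g i)) ->
  (forall i j : 'I_n, (j < i)%N -> phi j (g i) = 0%R) ->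
  (forall i, phi i (g i) <> 0%R) ->
  has_rank K n.
Proof.
move=> SK Sn phiM Kg phi0 phiN.
have lower S' : generated S' = K -> `I_n #<= S'.
  move=> S'K; have [fS'|/infiniteP/(card_le_trans _)->//] := pselect (finite_set S').
    have [m] := (finite_setP _).1 fS'; rewrite card_eq_le => /andP[S'm mS'].
    apply: card_le_trans mS'; rewrite card_le_II.
    exact: leq_independent S'K S'm phiM Kg phi0 phiN.
  exact: subset_card_le.
split=> //; exists S; split=> //.
by rewrite card_eq_le Sn lower.
Qed.

End SubgroupTheory.

(** * Words, automata and actions of free groups *)

Section Words.
Variable T : choiceType.
Implicit Types (a b : T * bool) (u v w : seq (T * bool)) (g h : free_group T).

Definition letter a : free_group T := FreeWord (isT : reduced [:: a]).

Lemma fg_word_inj : injective (@fg_word T).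
Proof. exact: val_inj. Qed.

Lemma inv_letter_neq a : (inv_letter a == a) = false.
Proof. by case: a => c []; apply/eqP => -[]. Qed.

Lemma word_mul_reduced u v : reduced (u ++ v) -> word_mul u v = u ++ v.
Proof.
elim: u => [//|a u IHu] /= ruv; rewrite IHu ?(reduced_behead ruv) //.
by case: (u ++ v) ruv => [//|b w] /= /andP[/negPf->].
Qed.

Lemma reduced_catl u v : reduced (u ++ v) -> reduced u.
Proof. by move=> /cat_sorted2[]. Qed.

Lemma reduced_catr u v : reduced (u ++ v) -> reduced v.
Proof. by move=> /cat_sorted2[]. Qed.

Lemma reduced_rcons2 w a b :
  reduced (rcons (rcons w a) b) = reduced (rcons w a) && (b != inv_letter a).
Proof.
rewrite /reduced -!cats1 -catA /= sorted_cat_cons /= andbT.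
by rewrite cats1.
Qed.

Lemma reduced_glue w a v :
  reduced (rcons w a) -> reduced (a :: v) -> reduced (w ++ a :: v).
Proof. by rewrite /reduced sorted_cat_cons => ->. Qed.

Lemma letterV a : (letter a)^-1 = letter (inv_letter a).
Proof. exact: fg_word_inj. Qed.

Lemma fg_word_mul g h :
  reduced (fg_word g ++ fg_word h) -> fg_word (g * h) = fg_word g ++ fg_word h.
Proof. exact: word_mul_reduced. Qed.

Lemma fg_word_rcons g a :
  reduced (rcons (fg_word g) a) -> fg_word (g * letter a) = rcons (fg_word g) a.
Proof. by rewrite -cats1 => r; rewrite fg_word_mul. Qed.

Lemma fg_word_inv g : fg_word g^-1 = word_inv (fg_word g).
Proof. by []. Qed.

Lemma word_inv_rcons w a : word_inv (rcons w a) = inv_letter a :: word_inv w.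
Proof. by rewrite /word_inv map_rcons rev_rcons. Qed.

Lemma word_inv_cons w a : word_inv (a :: w) = rcons (word_inv w) (inv_letter a).
Proof. by rewrite /word_inv map_cons rev_cons. Qed.

Lemma word_inv_cat u v : word_inv (u ++ v) = word_inv v ++ word_inv u.
Proof. by rewrite /word_inv map_cat rev_cat. Qed.

Lemma extend_or_cancel g a :
  reduced (rcons (fg_word g) a) \/
  exists h, g = h * letter (inv_letter a) /\ fg_word g = rcons (fg_word h) (inv_letter a).
Proof.
case: (boolP (reduced (rcons g a))) => [|nr]; [by left|right].
case: g nr => w; case/lastP: w => [//|w b] rw /=.
rewrite reduced_rcons2 [reduced _]rw /= negbK => /eqP ab.
have rw' : reduced w by move: rw; rewrite -cats1 => /reduced_catl.
have ba : b = inv_letter a by rewrite ab inv_letterK.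
exists (FreeWord rw'); split=> /=; last by rewrite ba.
by apply: fg_word_inj; rewrite fg_word_rcons /= -?ba.
Qed.

Lemma cancel_uniq g a b :
  ~~ reduced (rcons (fg_word g) a) -> ~~ reduced (rcons (fg_word g) b) -> a = b.
Proof.
case: g => w /=; case/lastP: w => [//|w l] rw.
by rewrite !reduced_rcons2 [reduced _]rw /= !negbK => /eqP-> /eqP->.
Qed.

Definition fg_take n g : free_group T :=
  FreeWord (take_sorted n (fg_reduced g) : reduced (take n g)).

Lemma fg_take_prefix g h :
  prefix (fg_word g) (fg_word h) -> fg_take (size (fg_word g)) h = g.
Proof. by rewrite prefixE => /eqP gh; apply: fg_word_inj. Qed.

Lemma free_group_ind (P : free_group T -> Prop) :
  P 1 ->
  (forall g a, reduced (rcons (fg_word g) a) -> P g -> P (g * letter a)) ->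
  forall g, P g.
Proof.
move=> P1 Pa; case=> w; elim/last_ind: w => [|w a IHw] rw.
  by rewrite (_ : FreeWord rw = 1) //; apply: fg_word_inj.
have rw' : reduced w by move: rw; rewrite -cats1 => /reduced_catl.
rewrite (_ : FreeWord rw = FreeWord rw' * letter a); first exact: Pa.
by apply: fg_word_inj; rewrite fg_word_rcons.
Qed.

End Words.

Section Automaton.
Variables (T : choiceType) (S : Type) (delta : T * bool -> S -> option S).
Hypothesis deltaV :
  forall a s s', delta a s = Some s' -> delta (inv_letter a) s' = Some s.
Implicit Types (a : T * bool) (u v w : seq (T * bool)) (s : S).

Fixpoint run w s := if w is a :: w' then obind (run w') (delta a s) else Some s.

Lemma run_cons a w s : run (a :: w) s = obind (run w) (delta a s).
Proof. by []. Qed.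

Lemma run_rcons w a s : run (rcons w a) s = obind (delta a) (run w s).
Proof.
elim: w s => [|b w IHw] s /=; first by case: (delta a s).
by case: (delta b s) => //=.
Qed.

Lemma run_cat u v s : run (u ++ v) s = obind (run v) (run u s).
Proof. by elim: u s => [//|a u IHu] s /=; case: (delta a s) => //=. Qed.

Lemma run_push a w s s' : run (a :: w) s = Some s' -> run (push a w) s = Some s'.
Proof.
case: w => [//|b w]; rewrite [push _ _]/=; case: eqVneq => [->|//] /=.
by case as1: (delta a s) => [s1|] //=; rewrite (deltaV as1).
Qed.

Lemma run_mul u v s s1 s2 :
  run u s = Some s1 -> run v s1 = Some s2 -> run (word_mul u v) s = Some s2.
Proof.
elim: u s => [|a u IHu] s /=; first by move=> [->].
case as1: (delta a s) => [s'|] //= us vs.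
by apply: run_push; rewrite /= as1 /=; apply: IHu.
Qed.

Lemma run_inv u s s' : run u s = Some s' -> run (word_inv u) s' = Some s.
Proof.
elim: u s => [|a u IHu] s /=; first by move=> [->].
case as1: (delta a s) => [s1|] //= /IHu us.
by rewrite word_inv_cons -cats1 run_cat us /= (deltaV as1).
Qed.

End Automaton.

Section RightAction.
Variables (T : choiceType) (S : Type) (delta : T * bool -> S -> S).
Hypothesis deltaK : forall a, cancel (delta a) (delta (inv_letter a)).
Implicit Types (g h : free_group T) (s : S).

Definition act s g := foldl (fun s a => delta a s) s (fg_word g).

Lemma act1 s : act s 1 = s. Proof. by []. Qed.

Lemma actM s g h : act s (g * h) = act (act s g) h.
Proof.
rewrite /act [fg_word (g * h)]/(word_mul g h).
elim: (fg_word g) s => [//|a u IHu] s /=.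
rewrite -IHu; case: (foldr _ _ u) => [//|b w] /=.
by case: (b =P inv_letter a) => [->|//]; rewrite deltaK.
Qed.

Lemma act_letter s a : act s (letter a) = delta a s. Proof. by []. Qed.

End RightAction.

(** * The Schreier graph of a subgroup of a free group *)

Section Transversal.
Variable T : finType.
Local Notation F := (free_group T).
Implicit Types (a b : T * bool) (u v : seq (T * bool)) (g h w z : F).

(** Bijective numeration: comparing codes is the length-lexicographic order, so
    appending a letter is strictly monotone. *)
Definition code u : nat :=
  foldl (fun n a => n * #|{: T * bool}| + (enum_rank a).+1)%N 0 u.

Lemma code_rcons u a :
  code (rcons u a) = (code u * #|{: T * bool}| + (enum_rank a).+1)%N.
Proof. by rewrite /code foldl_rcons. Qed.

Lemma code_rcons_lt u v a b :
  (code u < code v)%N -> (code (rcons u a) < code (rcons v b))%N.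
Proof.
move=> lt_uv; rewrite !code_rcons.
have := ltn_ord (enum_rank a); set K := #|_| => lt_aK.
have := leq_mul lt_uv (leqnn K); rewrite mulSn; lia.
Qed.

Lemma code_inj : injective code.
Proof.
have code0 : code [::] = 0 by [].
elim/last_ind => [|u a IHu] v; case/lastP: v => [//|v b].
- by rewrite code_rcons code0; lia.
- by rewrite code_rcons code0; lia.
case: (ltngtP (code u) (code v)) => [/(code_rcons_lt a b)|/(code_rcons_lt b a)|].
- by move=> lt e; rewrite e ltnn in lt.
- by move=> lt e; rewrite e ltnn in lt.
move=> euv; rewrite !code_rcons euv (IHu _ euv) => /addnI[] ab.
by congr rcons; apply/enum_rank_inj/val_inj.
Qed.

Lemma code_lt_rcons u a : (code u < code (rcons u a))%N.
Proof.
have := ltn_ord (enum_rank a); rewrite code_rcons; set K := #|_| => lt_aK.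
by have := leq_pmulr (code u) (leq_ltn_trans (leq0n _) lt_aK); lia.
Qed.

Lemma code_mul_letter g a : (code (g * letter a)%g <= code (rcons g a))%N.
Proof.
have [r|[h [-> ->]]] := extend_or_cancel g a; first by rewrite fg_word_rcons.
rewrite -mulgA -letterV mulVg mulg1.
by apply/ltnW/(ltn_trans (code_lt_rcons h (inv_letter a)))/code_lt_rcons.
Qed.

Section Subgroup.
Variable H : set F.
Hypothesis Hg : is_subgroup H.

Definition minimal_rep g w :=
  H (w * g^-1) /\ forall z, H (z * g^-1) -> (code w <= code z)%N.

(** The Schreier transversal of the right cosets of [H]. *)
Definition rep g : F := xget 1 (minimal_rep g).

(** The vertices of the spanning tree of the Schreier graph. *)
Definition tree g := rep g = g.

Lemma coset_sym g h : H (g * h^-1) -> H (h * g^-1).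
Proof. by move=> /(subVg Hg); rewrite invgM invgK. Qed.

Lemma coset_trans h g w : H (g * h^-1) -> H (h * w^-1) -> H (g * w^-1).
Proof. by move=> gh hw; have := subMg Hg gh hw; rewrite mulgA mulgVK. Qed.

Lemma coset_mul g h z : H (g * h^-1) -> H ((g * z) * (h * z)^-1).
Proof. by rewrite mulgKA. Qed.

Lemma rep_minimal g : minimal_rep g (rep g).
Proof.
rewrite /rep; case: xgetP => [w -> //|noP].
have ex : exists n, `[<exists w, H (w * g^-1) /\ code w = n>].
  by exists (code g); apply/asboolP; exists g; rewrite mulgV; split=> //; exact: sub1g.
have [n /asboolP[w [Hw cw]] mn] := ex_minnP ex.
case: (noP w); split=> // z Hz; rewrite cw; apply: mn.
by apply/asboolP; exists z.
Qed.

Lemma rep_coset g : H (rep g * g^-1).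
Proof. by case: (rep_minimal g). Qed.

Lemma rep_eq g h : H (g * h^-1) -> rep g = rep h.
Proof.
move=> gh; rewrite /rep; congr xget; apply/funext => w; apply/propext.
have eqc z : H (z * g^-1) <-> H (z * h^-1).
  by split=> Hz; [exact: coset_trans Hz gh|exact: coset_trans Hz (coset_sym gh)].
by split=> -[/eqc Hw mw]; split=> // z /eqc; apply: mw.
Qed.

Lemma rep_tree g : tree (rep g).
Proof. exact/rep_eq/rep_coset. Qed.

Lemma rep_mulr g z : rep (rep g * z) = rep (g * z).
Proof. exact/rep_eq/coset_mul/rep_coset. Qed.

Lemma tree1 : tree 1.
Proof.
apply/fg_word_inj/code_inj/eqP; rewrite -leqn0.
by have [_ /(_ 1)] := rep_minimal 1; apply; rewrite invg1 mulg1; exact: sub1g.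
Qed.

Lemma rep_mem g : H g -> rep g = 1.
Proof. by move=> Kg; rewrite -tree1; apply: rep_eq; rewrite invg1 mulg1. Qed.

Lemma rep_mulK g h : H g -> rep (g * h) = rep h.
Proof. by move=> Kg; apply: rep_eq; rewrite mulgK. Qed.

(** If [g] were not the least representative of its coset, replacing the prefix
    [g] by a smaller one would decrease the code of [g * letter a]. *)
Lemma tree_belast g a : reduced (rcons g a) -> tree (g * letter a) -> tree g.
Proof.
move=> r tga; have [Hk mk] := rep_minimal g; have [_ mka] := rep_minimal (g * letter a).
apply/fg_word_inj/code_inj/eqP; rewrite eqn_leq mk ?mulgV; last exact: sub1g.
rewrite /= leqNgt; apply/negP => /(code_rcons_lt a a).
rewrite -(fg_word_rcons r) ltnNge => /negP; apply.
apply: leq_trans (code_mul_letter _ _).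
by rewrite -{1}tga; apply: mka; apply: coset_mul.
Qed.

Lemma tree_prefix h g : tree h -> prefix (fg_word g) (fg_word h) -> tree g.
Proof.
elim/free_group_ind: h => [|h a r IHh] th.
  rewrite [fg_word 1]/= prefixs0 => /eqP g1.
  by rewrite (_ : g = 1) ?tree1 //; apply: fg_word_inj.
rewrite fg_word_rcons // => /prefixP[s]; case/lastP: s => [|s b].
  rewrite cats0 => hg; rewrite (_ : g = h * letter a) //.
  by apply: fg_word_inj; rewrite fg_word_rcons.
rewrite -rcons_cat => /eqP; rewrite eqseq_rcons => /andP[/eqP hs _].
by apply: IHh; [exact: tree_belast th|rewrite hs prefix_prefix].
Qed.

Definition nontree_edge g a :=
  [/\ tree g, reduced (rcons g a) & ~ tree (g * letter a)].

(** The reduced words that leave the spanning tree with their last letter. They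
    form a prefix code, in bijection with the oriented edges outside of the tree. *)
Definition leaf w := exists g a, nontree_edge g a /\ w = g * letter a.

(** One orientation of each edge outside of the spanning tree. *)
Definition pos_leaf w := exists g c, nontree_edge g (c, false) /\ w = g * letter (c, false).

Definition schreier_gen w := w * (rep w)^-1.

Lemma schreier_gen_mem w : H (schreier_gen w).
Proof. exact/coset_sym/rep_coset. Qed.

(** Read backwards, an edge outside of the spanning tree starts from the
    representative of its end: were this not reduced, the edge would be the one by
    which the tree reaches that representative. *)
Lemma nontree_edge_flip g a : nontree_edge g a ->
  nontree_edge (rep (g * letter a)) (inv_letter a)
  /\ rep (rep (g * letter a) * letter (inv_letter a)) = g.
Proof.
move=> [tg r nt].
have repV : rep (rep (g * letter a) * letter (inv_letter a)) = g.
  by rewrite rep_mulr -letterV mulgK.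
split=> //; split; first exact: rep_tree.
- have [//|[h [ew we]]] := extend_or_cancel (rep (g * letter a)) (inv_letter a).
  rewrite inv_letterK in ew we; case: nt.
  have th : tree h by apply: (tree_prefix (rep_tree (g * letter a))); rewrite we prefix_rcons.
  have gh : g = h.
    by rewrite -repV ew -letterV mulgK.
  by rewrite gh -ew; apply: rep_tree.
move=> t; rewrite /tree repV in t; case: nt.
by rewrite {1}t -letterV mulgVK; apply: rep_tree.
Qed.

Lemma schreier_gen_flip g a :
  nontree_edge g a ->
  schreier_gen (rep (g * letter a) * letter (inv_letter a))
    = (schreier_gen (g * letter a))^-1.
Proof.
move=> e; have [_ repV] := nontree_edge_flip e.
by rewrite /schreier_gen repV invgM invgK -letterV -mulgA -invgM.
Qed.

Lemma pos_leaf_leaf w : pos_leaf w -> leaf w.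
Proof. by move=> [g [c [e ->]]]; exists g, (c, false). Qed.

Lemma leaf_not_tree w : leaf w -> ~ tree w.
Proof. by move=> [g [a [[_ _ nt] ->]]]. Qed.

Lemma leaf_proper_prefix w g :
  leaf w -> prefix (fg_word g) (fg_word w) -> g <> w -> tree g.
Proof.
move=> [h [a [[th r _] ->]]]; rewrite fg_word_rcons // => /prefixP[s].
case/lastP: s => [|s b]; first by rewrite cats0 -fg_word_rcons // => /fg_word_inj<-.
rewrite -rcons_cat => /eqP; rewrite eqseq_rcons => /andP[/eqP hg _] _.
by apply: (tree_prefix th); rewrite hg prefix_prefix.
Qed.

Lemma leaf_prefix w z : leaf w -> leaf z -> prefix (fg_word w) (fg_word z) -> w = z.
Proof.
move=> Lw Lz wz; apply: contra_notP (leaf_not_tree Lw) => nwz.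
exact: leaf_proper_prefix wz nwz.
Qed.

Lemma exists_leaf g a z :
  tree g -> ~ tree z -> prefix (rcons g a) z ->
  exists w, [/\ leaf w, prefix (rcons g a) w & prefix w z].
Proof.
move=> tg; elim/free_group_ind: z => [|z b r IHz] nt.
  by rewrite [fg_word 1]/= prefixs0; case: (fg_word g).
have [tz|ntz] := pselect (tree z).
  move=> pz; exists (z * letter b); split=> //; last exact: prefix_refl.
  by exists z, b.
rewrite fg_word_rcons // => /prefixP[s]; case/lastP: s => [|s c].
  rewrite cats0 => /eqP; rewrite eqseq_rcons => /andP[/eqP zg _].
  by case: ntz; rewrite (fg_word_inj zg).
rewrite -rcons_cat => /eqP; rewrite eqseq_rcons => /andP[/eqP zg _].
have [|w [Lw gw wz]] := IHz ntz; first by rewrite zg prefix_prefix.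
by exists w; split=> //; apply: prefix_trans wz (prefix_rcons _ _).
Qed.

Lemma schreier_gen_word w :
  leaf w -> fg_word (schreier_gen w) = fg_word w ++ word_inv (fg_word (rep w)).
Proof.
move=> [g [a [e ->]]]; have [[_ rV _] _] := nontree_edge_flip e.
have [_ r _] := e; apply: word_mul_reduced; rewrite fg_word_rcons // cat_rcons.
apply: reduced_glue => //.
by have := reduced_inv rV; rewrite word_inv_rcons inv_letterK.
Qed.

(** Rewriting a word letter by letter along the transversal expresses it as a
    product of the edges that it crosses outside of the spanning tree. *)
Lemma schreier_generated : generated (schreier_gen @` pos_leaf) = H.
Proof.
apply: generatedP => // [_ [w _ <-]|]; first exact: schreier_gen_mem.
set K := generated _; have Kg : is_subgroup K by apply: generated_subgroup.
suff Kw g : K (g * (rep g)^-1).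
  by move=> g Hh; have := Kw g; rewrite rep_mem // invg1 mulg1.
have step h a : tree h -> K (h * letter a * (rep (h * letter a))^-1).
  move=> th; have [r|[h' [hh' eh]]] := extend_or_cancel h a; last first.
    have th' : tree h' by apply: (tree_prefix th); rewrite eh prefix_rcons.
    by rewrite hh' -letterV mulgVK th' mulgV; apply: sub1g.
  have [t|nt] := pselect (tree (h * letter a)); first by rewrite t mulgV; apply: sub1g.
  have e : nontree_edge h a by [].
  rewrite -[_ * _^-1]/(schreier_gen _); case: a => c [] in r nt e *; last first.
    by apply: mem_generated; exists (h * letter (c, false)) => //; exists h, c.
  have [eV repV] := nontree_edge_flip e.
  rewrite -(invgK (schreier_gen _)) -schreier_gen_flip //; apply: (subVg Kg).
  apply: mem_generated; exists (rep (h * letter (c, true)) * letter (c, false)) => //.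
  by exists (rep (h * letter (c, true))), c.
elim/free_group_ind: g => [|g a r IHg]; first by rewrite tree1 mulgV; apply: sub1g.
have := subMg Kg IHg (step _ a (rep_tree g)).
by rewrite rep_mulr !mulgA mulgVK.
Qed.

End Subgroup.
End Transversal.

Arguments coset_sym {T H} Hg {g h}.
Arguments coset_trans {T H} Hg {h g w}.

(** * Crossing numbers and the abelianization *)

Section Crossing.
Variables (T : finType) (H : set (free_group T)).
Hypothesis Hg : is_subgroup H.
Local Notation F := (free_group T).
Implicit Types (a : T * bool) (g h w z : F).

Section OneEdge.
Variable w0 : F.

Definition crosses g a : bool :=
  `[< [/\ nontree_edge H (rep H g) a, a.2 = false & rep H g * letter a = w0] >].

Definition crossing_step a (s : F * int) : F * int :=
  (s.1 * letter a,
   (s.2 + ((crosses s.1 a)%:Z - (crosses (s.1 * letter a)%g (inv_letter a))%:Z))%R).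

Lemma crossing_stepK a : cancel (crossing_step a) (crossing_step (inv_letter a)).
Proof.
move=> [g n]; rewrite /crossing_step /= -letterV inv_letterK mulgK.
by congr pair; lia.
Qed.

Definition crossing_from g z : int := (act crossing_step (g, 0%R : int) z).2.

(** The algebraic number of times that the path of a word crosses a given edge
    of the Schreier graph. *)
Definition crossing z : int := crossing_from 1 z.

Lemma act_crossing g n z :
  act crossing_step (g, n) z = (g * z, (n + crossing_from g z)%R).
Proof.
rewrite /crossing_from; elim/free_group_ind: z => [|z a r IHz].
  by rewrite !act1 mulg1 /= addr0.
have [m em] : exists m, act crossing_step (g, 0%R : int) z = (g * z, m).
  have : (act crossing_step (g, 0%R : int) z).1 = g * z.
    elim/free_group_ind: z {r IHz} => [|z b r IHz]; first by rewrite mulg1.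
    by rewrite (actM crossing_stepK) act_letter /= IHz mulgA.
  by case: (act _ _ _) => g' m /= ->; exists m.
rewrite !(actM crossing_stepK) IHz em !act_letter /crossing_step /= mulgA.
by congr pair; apply/esym/addrA.
Qed.

Lemma crossing_fromM g z1 z2 :
  crossing_from g (z1 * z2) = (crossing_from g z1 + crossing_from (g * z1)%g z2)%R.
Proof.
by rewrite {1}/crossing_from (actM crossing_stepK) !act_crossing /= add0r.
Qed.

Lemma crossing_from_letter g a :
  crossing_from g (letter a) =
  ((crosses g a)%:Z - (crosses (g * letter a)%g (inv_letter a))%:Z)%R.
Proof. by rewrite /crossing_from act_letter /= add0r. Qed.

Lemma crossesMl h g a : H h -> crosses (h * g) a = crosses g a.
Proof. by move=> Hh; rewrite /crosses rep_mulK. Qed.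

Lemma crossing_fromMl h g z : H h -> crossing_from (h * g) z = crossing_from g z.
Proof.
move=> Hh; elim/free_group_ind: z => [//|z a r IHz].
rewrite !crossing_fromM IHz !crossing_from_letter -(mulgA h g z).
by rewrite -(mulgA h (g * z)) !(crossesMl _ _ Hh).
Qed.

Lemma crossingM h z : H h -> crossing (h * z) = (crossing h + crossing z)%R.
Proof.
move=> Hh; rewrite /crossing crossing_fromM mul1g.
by have := crossing_fromMl 1 z Hh; rewrite mulg1 => ->.
Qed.

Lemma crossing_tree z : tree H z -> crossing z = 0%R.
Proof.
rewrite /crossing; elim/free_group_ind: z => [//|z a r IHz] tza.
have tz := tree_belast Hg r tza; rewrite crossing_fromM IHz // mul1g.
rewrite crossing_from_letter /crosses !asboolF ?subrr ?addr0 //.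
- move=> [[_ r' _] _ _]; move: r'.
  by rewrite tza fg_word_rcons // reduced_rcons2 eqxx andbF.
- by move=> [[_ _ +] _ _]; rewrite tz.
Qed.

Lemma crossing_schreier_gen w : pos_leaf H w -> crossing (schreier_gen H w) = (w == w0)%:Z%R.
Proof.
move=> [g [c [e ->]]]; have [tg r nt] := e.
rewrite /schreier_gen /crossing !crossing_fromM !mul1g.
rewrite [crossing_from 1 g](crossing_tree tg) add0r.
have -> : crossing_from (g * letter (c, false)) (rep H (g * letter (c, false)))^-1 = 0%R.
  set v := g * _; have := crossing_fromMl (rep H v) (rep H v)^-1 (schreier_gen_mem Hg v).
  rewrite mulgVK => ->; have : crossing_from 1 (rep H v * (rep H v)^-1) = 0%R by rewrite mulgV.
  rewrite crossing_fromM mul1g.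
  by rewrite [crossing_from 1 _](crossing_tree (rep_tree Hg v)) add0r.
rewrite addr0 crossing_from_letter.
rewrite [crosses (g * _) _]asboolF ?subr0; last by move=> [_ /=].
congr (Posz (nat_of_bool _)); rewrite /crosses tg.
by apply/asboolP/eqP => [[]|].
Qed.

End OneEdge.

(** The Schreier generators have lifts, on which the crossing numbers are
    independent; an element over the identity adds one dimension, seen by the
    second projection. *)
Lemma pos_leaf_card_central (S K : set (F * Algebra.to_multiplicative int)) n
    (m : int) :
  generated S = K -> S #<= `I_n -> fst @` K = H -> K (1, m) -> m <> 0%R ->
  pos_leaf H #<= `I_n.-1.
Proof.
move=> SK Sn KH Km m0; apply: card_le_bound => s us sL.
pose lift g := xget (1, m) [set k | K k /\ k.1 = g].
have liftP g : H g -> K (lift g) /\ (lift g).1 = g.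
  rewrite -KH => -[k Kk kg]; rewrite /lift.
  by case: xgetP => [k' _ [] //|/(_ k)[]].
pose leaf_of (i : 'I_(size s).+1) := nth 1 s i.
have leafP (i : 'I_(size s).+1) : (i < size s)%N -> pos_leaf H (leaf_of i).
  by move=> lt_is; apply: sL; rewrite /= mem_nth.
pose gen (i : 'I_(size s).+1) := if (i < size s)%N then lift (schreier_gen H (leaf_of i)) else (1, m).
pose phi (i : 'I_(size s).+1) (k : F * Algebra.to_multiplicative int) : int :=
  if (i < size s)%N then crossing (leaf_of i) k.1 else k.2.
have genP (i : 'I_(size s).+1) : (i < size s)%N ->
    K (gen i) /\ (gen i).1 = schreier_gen H (leaf_of i).
  by move=> lt_is; rewrite /gen lt_is; exact: liftP (schreier_gen_mem Hg _).
suff: (size s < n)%N by case: n {Sn}.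
apply: (@leq_independent _ K S n _ gen phi) => //.
- move=> i a b Ka Kb; rewrite /phi; case: ifP => // _.
  by rewrite crossingM // -KH; exists a.
- by move=> i; case: (ltnP i (size s)) => [/genP[]//|]; rewrite /gen ltnNge => ->.
- move=> i j lt_ji; have lt_js : (j < size s)%N.
    by apply: leq_trans lt_ji _; rewrite -ltnS.
  rewrite /phi lt_js; case: (ltnP i (size s)) => [lt_is|].
    have [_ ->] := genP _ lt_is; rewrite crossing_schreier_gen; last exact: leafP.
    by rewrite /leaf_of nth_uniq // gtn_eqF.
  by rewrite /gen ltnNge => -> /=.
- move=> i; rewrite /phi; case: ifP => lt_is; last by rewrite /gen lt_is.
  have [_ ->] := genP _ lt_is; rewrite crossing_schreier_gen; last exact: leafP.
  by rewrite eqxx.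
Qed.

(** The crossing numbers are dual to the Schreier generators, which are thus
    independent in the abelianization. *)
Lemma pos_leaf_card (S : set F) n :
  generated S = H -> S #<= `I_n -> pos_leaf H #<= `I_n.
Proof.
move=> SH Sn; apply: card_le_bound => s us sL.
pose leaf_of (i : 'I_(size s)) := nth 1 s i.
have leafP i : pos_leaf H (leaf_of i) by apply: sL; rewrite /= mem_nth.
apply: (@leq_independent _ H S n _ (fun i => schreier_gen H (leaf_of i))
          (fun i => crossing (leaf_of i))) => //.
- by move=> i a b Ha _; apply: crossingM.
- by move=> i; apply: schreier_gen_mem.
- move=> i j lt_ji; rewrite crossing_schreier_gen; last exact: leafP.
  by rewrite /leaf_of nth_uniq // gtn_eqF.
- by move=> i; rewrite crossing_schreier_gen ?eqxx //; exact: leafP.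
Qed.

End Crossing.

(** * Branch vertices of the intersection of two subgroups *)

Section Branching.
Variable T : finType.
Local Notation F := (free_group T).
Implicit Types (a b : T * bool) (u v r : seq (T * bool)) (g h w z : F) (H K : set F).

(** The map [flip] sends the positive orientation of an edge to the leaf of its
    reverse. *)
Lemma leaf_card H n : is_subgroup H -> pos_leaf H #<= `I_n -> leaf H #<= `I_(n + n).
Proof.
move=> Hg /card_le_seqP[s lesn Ls].
have mem_s w : pos_leaf H w -> w \in s by rewrite Ls.
pose flip w := rep H w * (w^-1 * fg_take (size w).-1 w).
apply: (@card_le_trans _ _ _ `I_(size (s ++ map flip s))); last first.
  by rewrite card_le_II size_cat size_map leq_add.
apply: card_le_mem => w [g [[c []] [e ->]]] /=; rewrite mem_cat; last first.
  by rewrite mem_s //; exists g, c.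
have [eV repV] := nontree_edge_flip Hg e.
set v := rep H (g * letter (c, true)) * letter (c, false).
have vs : v \in s.
  by apply: mem_s; exists (rep H (g * letter (c, true))), c.
apply/orP; right; apply/mapP; exists v => //; rewrite /flip.
have [_ rV _] := eV.
have -> : fg_take (size v).-1 v = rep H (g * letter (c, true)).
  have wv := fg_word_rcons rV.
  by rewrite wv size_rcons [_.-1]/= fg_take_prefix // wv prefix_rcons.
by rewrite [rep H v]repV invgM mulgVK letterV.
Qed.

Fixpoint meet (u v : seq (T * bool)) :=
  match u, v with
  | a :: u', b :: v' => if a == b then a :: meet u' v' else [::]
  | _, _ => [::]
  end.

Lemma meet_rcons u v r a b :
  a != b -> prefix (rcons r a) u -> prefix (rcons r b) v -> meet u v = r.
Proof.
move=> ab; elim: r u v => [|c r IHr] [|d u] [|e v] //=.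
  by move=> /andP[/eqP<- _] /andP[/eqP<- _]; rewrite (negPf ab).
by move=> /andP[/eqP<- ru] /andP[/eqP<- rv]; rewrite eqxx (IHr _ _ ru rv).
Qed.

Lemma meetP u v : ~~ prefix u v -> ~~ prefix v u ->
  exists r a b, [/\ a != b, prefix (rcons r a) u & prefix (rcons r b) v].
Proof.
elim: u v => [|a u IHu] [|b v] //=.
rewrite [b == a]eq_sym; case: eqVneq => [<- /= uv vu|ab _ _].
  have [w [c [d [cd wu wv]]]] := IHu _ uv vu.
  by exists (a :: w), c, d; rewrite cd /= eqxx.
by exists [::], a, b; rewrite ab /= !eqxx !prefix0s.
Qed.

(** The vertices at which the paths of two leaves part. *)
Definition branch H g := exists w z a b,
  [/\ leaf H w, leaf H z, a != b, prefix (rcons g a) w & prefix (rcons g b) z].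

Lemma branch_card H n : leaf H #<= `I_n -> branch H #<= `I_(n * n).
Proof.
move=> /card_le_seqP[s lesn Ls].
pose m w z := fg_take (size (meet w z)) w.
apply: (@card_le_trans _ _ _ `I_(size [seq m w z | w <- s, z <- s])); last first.
  by rewrite card_le_II size_allpairs leq_mul.
apply: card_le_mem => g [w [z [a [b [Lw Lz ab gw gz]]]]].
apply/allpairsP; exists (w, z); split=> /=; first by move: Lw; rewrite Ls.
  by move: Lz; rewrite Ls.
rewrite /m (meet_rcons ab gw gz) fg_take_prefix //.
exact: prefix_trans (prefix_rcons _ _) gw.
Qed.

(** A leaf is determined by its last branch vertex and the letter that follows:
    two leaves sharing these would part at a later branch vertex. *)
Lemma leaf_card_branch H n : is_subgroup H ->
  branch H #<= `I_n -> leaf H #<= `I_(n.+1 * #|{: T * bool}|).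
Proof.
move=> Hg /card_le_seqP[s lesn Bs].
have mem_s g : branch H g -> g \in s by rewrite Bs.
pose B w (i : nat) := `[<branch H (fg_take i w)>].
(* The root, of index 0, is the default value for a leaf without branch vertex. *)
pose last_branch w := (\max_(i < size w | B w i) i)%N.
pose f w := (fg_take (last_branch w) w, ohead (drop (last_branch w) w)).
pose codom := [seq (g, Some a) | g <- 1 :: s, a <- enum {: T * bool}].
apply: (@card_le_trans _ _ _ `I_(size codom)); last first.
  by rewrite card_le_II size_allpairs /= -cardE leq_mul2r ltnS lesn orbT.
apply: (@card_le_trans _ _ _ [set` codom]); last exact: card_le_mem.
have meet_branch w g a : leaf H w -> branch H g -> prefix (rcons g a) w ->
    B w (last_branch w) /\ (size g <= last_branch w)%N.
  move=> Lw Bg gw; have lt_gw : (size g < size w)%N.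
    by have := size_prefix gw; rewrite size_rcons.
  have Bgw : B w (Ordinal lt_gw).
    by apply/asboolP; rewrite fg_take_prefix //; apply: prefix_trans gw; apply: prefix_rcons.
  split; last exact: (@leq_bigmax_cond _ (fun i : 'I_(size w) => B w i) (@nat_of_ord _) _ Bgw).
  by rewrite /last_branch (bigop.bigmax_eq_arg (Ordinal lt_gw)) //; case: arg_maxnP.
apply: (@card_le_inj _ _ _ _ f) => [w Lw|w z Lw Lz].
  have lt_lb : (last_branch w < size w)%N.
    case: ltnP => // le_wl; have w0 : (0 < size w)%N.
      rewrite lt0n; apply/eqP => /size0nil w1; case: (leaf_not_tree Lw).
      by rewrite (_ : w = 1); [exact: tree1|exact: fg_word_inj].
    suff : (last_branch w <= (size w).-1)%N by lia.
    by apply/bigmax_leqP => i _; have := ltn_ord i; lia.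
  apply/allpairsP; have [a da] : exists a, ohead (drop (last_branch w) w) = Some a.
    case: (drop _ w) (size_drop (last_branch w) w) => [|a r] /=; last by exists a.
    by move: lt_lb => /[swap] /=; lia.
  exists (fg_take (last_branch w) w, a); split; rewrite ?mem_enum //=; last first.
    by rewrite /f da.
  have [Bw|nBw] := pselect (exists i : 'I_(size w), B w i).
    rewrite inE; apply/orP; right; have [i Bi] := Bw.
    apply: mem_s; rewrite /last_branch (bigop.bigmax_eq_arg i) //.
    by case: arg_maxnP => // j /asboolP.
  rewrite inE (_ : last_branch w = 0%N).
    by rewrite (_ : fg_take 0 w = 1) ?eqxx //; apply: fg_word_inj; rewrite /= take0.
  by apply/big1 => i Bi; case: nBw; exists i.
move=> [fwz dwz]; apply: contrapT => nwz.
have [||u [a [b [ab uw uz]]]] := @meetP w z.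
- by apply/negP => /(leaf_prefix Hg Lw Lz).
- by apply/negP => /(leaf_prefix Hg Lz Lw)/esym.
have ru : reduced u.
  by move: uw => /prefixP[r]; case: w {Lw fwz dwz nwz} => w rw /= ew; move: rw;
     rewrite ew -cats1 -catA => /reduced_catl.
pose g := FreeWord ru.
have Bg : branch H g by exists w, z, a, b.
have [Bw gw] := meet_branch _ g a Lw Bg uw; have [Bz gz] := meet_branch _ g b Lz Bg uz.
have [Bw_ltw Bz_ltz] : (last_branch w <= size w /\ last_branch z <= size z)%N.
  by split; apply/bigmax_leqP => i _; apply/ltnW.
have lwz : last_branch w = last_branch z.
  by have := congr1 size fwz; rewrite /= !size_takel.
move: gw; rewrite leq_eqVlt => /orP[/eqP gw|gw].
  move: dwz; rewrite -lwz -gw; move: uw uz => /prefixP[r ->] /prefixP[r' ->].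
  by rewrite -!cats1 -!catA !drop_size_cat //= => -[/eqP]; rewrite (negPf ab).
have eq_nth k (x0 : T * bool) : (k < last_branch w)%N -> nth x0 w k = nth x0 z k.
  by move=> lk; rewrite -(nth_take _ lk) fwz nth_take -?lwz.
have := eq_nth (size g) a gw; move: uw uz => /prefixP[r ->] /prefixP[r' ->].
rewrite !nth_cat !size_rcons !ltnSn !nth_rcons ltnn eqxx => /eqP.
by rewrite (negPf ab).
Qed.

(** [a] is the direction, at the coset of [g], of some reduced closed path based
    at the trivial coset. *)
Definition core_dir H g a := exists z p u,
  [/\ H z, fg_word z = fg_word p ++ a :: u & H (p * g^-1)].

Lemma core_dir_sub H K g h a : is_subgroup K -> H `<=` K -> K (g * h^-1) ->
  core_dir H g a -> core_dir K h a.
Proof.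
move=> Kg HK gh [z [p [u [Hz zpu pg]]]]; exists z, p, u; split=> //; first exact: HK.
exact: (coset_trans Kg (HK _ pg) gh).
Qed.

(** A reduced closed path that passes a vertex of the spanning tree in a
    direction away from the root has to leave the spanning tree later. *)
Lemma core_dir_leaf H g a : is_subgroup H -> tree H g -> core_dir H g a ->
  reduced (rcons g a) -> exists w, leaf H w /\ prefix (rcons g a) w.
Proof.
move=> Hg tg [z [p [u [Hz zpu pg]]]] r.
have rgu : reduced (fg_word g ++ a :: u).
  apply: reduced_glue => //; apply: (@reduced_catr _ (fg_word p)).
  by rewrite -zpu; apply: fg_reduced.
have ru : reduced (a :: u) by apply: reduced_catr rgu.
have e : FreeWord rgu = g * p^-1 * z.
  have -> : z = p * FreeWord ru.
    by apply: fg_word_inj; rewrite fg_word_mul -?zpu //; apply: fg_reduced.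
  by rewrite mulgA mulgVK; apply: fg_word_inj; rewrite fg_word_mul.
have [|||w [Lw gw _]] := @exists_leaf _ H g a (FreeWord rgu) => //.
- rewrite /tree rep_mem //; last by rewrite e; apply: (subMg Hg) => //; apply: coset_sym.
  by move=> /(congr1 (@fg_word _)) /=; case: (fg_word g).
- by rewrite /= -cat_rcons prefix_prefix.
by exists w.
Qed.

Lemma core_dirs_branch H g a b c : is_subgroup H -> tree H g ->
  uniq [:: a; b; c] -> core_dir H g a -> core_dir H g b -> core_dir H g c ->
  branch H g.
Proof.
move=> Hg tg /=; rewrite !inE negb_or andbT => /andP[/andP[ab ac] bc] ga gb gc.
have two d e : d != e -> core_dir H g d -> core_dir H g e ->
    reduced (rcons g d) -> reduced (rcons g e) -> branch H g.
  move=> de gd ge rd re.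
  have [w [Lw gw]] := core_dir_leaf Hg tg gd rd.
  have [z [Lz gz]] := core_dir_leaf Hg tg ge re.
  by exists w, z, d, e.
case: (boolP (reduced (rcons g a))) => ra.
  case: (boolP (reduced (rcons g b))) => rb; first exact: (two a b).
  case: (boolP (reduced (rcons g c))) => rc; first exact: (two a c).
  by rewrite (cancel_uniq rb rc) eqxx in bc.
case: (boolP (reduced (rcons g b))) => rb; last by rewrite (cancel_uniq ra rb) eqxx in ab.
case: (boolP (reduced (rcons g c))) => rc; last by rewrite (cancel_uniq ra rc) eqxx in ac.
exact: (two b c).
Qed.

(** At a branch vertex, the Schreier generators of the two leaves that part there
    give closed paths in the two directions away from the root, and the inverse of
    one of them gives the direction towards the root. *)
Lemma branch_core_dirs H g : is_subgroup H -> branch H g -> g <> 1 ->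
  tree H g /\ exists a b c,
    [/\ uniq [:: a; b; c], core_dir H g a, core_dir H g b & core_dir H g c].
Proof.
move=> Hg [w [z [a [b [Lw Lz ab gw gz]]]]] g1.
have fwd h d : leaf H h -> prefix (rcons g d) h ->
    exists u, fg_word (schreier_gen H h) = fg_word g ++ d :: u.
  move=> Lh /prefixP[u hu]; rewrite schreier_gen_word // hu -cats1 -!catA /=.
  by exists (u ++ word_inv (rep H h)).
split.
  have gw' : prefix g w by apply: prefix_trans gw; apply: prefix_rcons.
  apply: leaf_proper_prefix Lw gw' _ => // gw''; move: gw; rewrite gw''.
  by move=> /size_prefix; rewrite size_rcons ltnn.
have dir h d : leaf H h -> prefix (rcons g d) h -> core_dir H g d.
  move=> Lh gh; have [u hu] := fwd h d Lh gh.
  exists (schreier_gen H h), g, u; split=> //; first exact: schreier_gen_mem.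
  by rewrite mulgV; apply: sub1g.
have [u wu] := fwd w a Lw gw; have [u' zu] := fwd z b Lz gz.
case: g g1 {dir} gw gz fwd wu zu (dir w a Lw gw) (dir z b Lz gz) => v.
case/lastP: v => [|v l] rv g1 gw gz fwd wu zu da db.
  by case: g1; apply: fg_word_inj.
set g := FreeWord rv in da db *; exists a, b, (inv_letter l).
have ra : reduced (rcons (rcons v l) a).
  rewrite -cats1; have := fg_reduced (schreier_gen H w); rewrite wu /=.
  by rewrite -cat_rcons cats1 => /reduced_catl.
have rb : reduced (rcons (rcons v l) b).
  rewrite -cats1; have := fg_reduced (schreier_gen H z); rewrite zu /=.
  by rewrite -cat_rcons cats1 => /reduced_catl.
split=> //.
  move: ra rb; rewrite !reduced_rcons2 => /andP[_ al] /andP[_ bl].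
  by rewrite /= !inE negb_or ab al bl.
have ru : reduced (word_inv (a :: u)).
  apply: reduced_inv; apply: (@reduced_catr _ (fg_word g)); rewrite -wu.
  exact: fg_reduced.
exists (schreier_gen H w)^-1, (FreeWord ru), (word_inv v).
have wi : fg_word (schreier_gen H w)^-1 =
    word_inv (a :: u) ++ inv_letter l :: word_inv v.
  by rewrite fg_word_inv wu word_inv_cat /= word_inv_rcons.
split=> //; first exact/(subVg Hg)/(schreier_gen_mem Hg).
have -> : FreeWord ru = (schreier_gen H w)^-1 * g.
  have wg : fg_word (FreeWord ru) ++ fg_word g^-1 = fg_word (schreier_gen H w)^-1.
    by rewrite [RHS]fg_word_inv wu word_inv_cat.
  have -> : (schreier_gen H w)^-1 = FreeWord ru * g^-1.
    by apply: fg_word_inj; rewrite fg_word_mul wg //; apply: fg_reduced.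
  by rewrite mulgVK.
by rewrite mulgK; apply/(subVg Hg)/(schreier_gen_mem Hg).
Qed.

(** The coset of a branch vertex of the intersection is determined by its cosets
    modulo the two subgroups, and these are branch vertices, except that the root
    need not branch in the two graphs. *)
Lemma branchI_card H K m n : is_subgroup H -> is_subgroup K ->
  branch H #<= `I_m -> branch K #<= `I_n ->
  branch (H `&` K) #<= `I_(m * n).+1.
Proof.
move=> Hg Kg /card_le_seqP[s lesm Bs] /card_le_seqP[s' lesn Bs'].
have mem_s g : branch H g -> g \in s by rewrite Bs.
have mem_s' g : branch K g -> g \in s' by rewrite Bs'.
(* The root need not be a branch vertex of the two graphs, whence the summand 1. *)
pose f g := if g == 1 then None else Some (rep H g, rep K g).
pose codom := None :: [seq Some (h, k) | h <- s, k <- s'].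
have HKg := subgroupI Hg Kg.
apply: (@card_le_trans _ _ _ `I_(size codom)); last first.
  by rewrite card_le_II /= size_allpairs ltnS leq_mul.
apply: (@card_le_trans _ _ _ [set` codom]); last exact: card_le_mem.
have repB L g a b c : is_subgroup L -> H `&` K `<=` L -> uniq [:: a; b; c] ->
    core_dir (H `&` K) g a -> core_dir (H `&` K) g b -> core_dir (H `&` K) g c ->
    branch L (rep L g).
  move=> Lg HKL ue ga gb gc.
  have dirL d : core_dir (H `&` K) g d -> core_dir L (rep L g) d.
    by apply: (core_dir_sub Lg HKL); apply/(coset_sym Lg)/(rep_coset Lg).
  exact: (core_dirs_branch Lg (rep_tree Lg g) ue (dirL _ ga) (dirL _ gb) (dirL _ gc)).
apply: (@card_le_inj _ _ _ _ f) => [g Bg|g h Bg Bh].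
  rewrite /f; case: eqP => [_|g1]; first by rewrite /= inE.
  have [_ [a [b [c [ue ga gb gc]]]]] := branch_core_dirs HKg Bg g1.
  rewrite /= inE; apply/orP; right; apply/allpairsP; exists (rep H g, rep K g).
  split=> //=.
    by apply: mem_s; apply: repB ue ga gb gc => // ? [].
  by apply: mem_s'; apply: repB ue ga gb gc => // ? [].
rewrite /f; case: eqP => [->|g1]; case: eqP => [->|h1] // [rH rK].
have [tg _] := branch_core_dirs HKg Bg g1; have [th _] := branch_core_dirs HKg Bh h1.
rewrite -tg -th; apply: (rep_eq HKg); split.
  by apply: (coset_trans Hg (coset_sym Hg (rep_coset Hg g))); rewrite rH; apply: (rep_coset Hg).
by apply: (coset_trans Kg (coset_sym Kg (rep_coset Kg g))); rewrite rK; apply: (rep_coset Kg).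
Qed.

End Branching.

(** * Normalizers of finitely generated subgroups *)

Section NormalSubgroups.
Variables (T : finType) (P : set (free_group T)).
Hypothesis Pg : is_subgroup P.
Local Notation F := (free_group T).
Implicit Types (a b : T * bool) (c g h w : F).

(** The end of the closed path [c] is represented by [t], not by [t * c]. *)
Lemma closed_path_leaf t c a u :
  tree P t -> fg_word c = a :: u -> reduced (rcons t a) -> P (t * c * t^-1) ->
  exists2 w, leaf P w & prefix (fg_word t) (fg_word w).
Proof.
move=> tt cau r Pc.
have tc : fg_word (t * c) = fg_word t ++ a :: u.
  rewrite fg_word_mul ?cau //; apply: reduced_glue => //.
  by rewrite -cau; apply: fg_reduced.
have [|||w [Lw tw _]] := @exists_leaf _ P t a (t * c) => //.
- rewrite /tree (rep_eq Pg Pc) tt => /(congr1 (fun g => size (fg_word g))).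
  by rewrite tc size_cat /=; lia.
- by rewrite tc -cat_rcons prefix_prefix.
by exists w => //; apply: prefix_trans tw; apply: prefix_rcons.
Qed.

(** A cyclically reduced closed path at a coset can be followed in one of its two
    orientations from the representative of that coset without cancellation, and
    it leaves the spanning tree because it comes back to its origin. *)
Lemma rep_leaf_prefix g c a u : fg_word c = a :: u -> last a u != inv_letter a ->
  P (g * c * g^-1) -> exists2 w, leaf P w & prefix (fg_word (rep P g)) (fg_word w).
Proof.
move=> cau cyc Pc; set t := rep P g; have tt : tree P t := rep_tree Pg g.
have Ptc : P (t * c * t^-1).
  have Ptg := rep_coset Pg g; have := subMg Pg (subMg Pg Ptg Pc) (subVg Pg Ptg).
  by rewrite invgM invgK !mulgA mulgVK mulgVK.
case: (boolP (reduced (rcons t a))) => [r|nr]; first exact: closed_path_leaf cau r Ptc.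
have cV : fg_word c^-1 = inv_letter (last a u) :: word_inv (belast a u).
  by rewrite fg_word_inv cau lastI word_inv_rcons.
apply: closed_path_leaf tt cV _ _; last first.
  by have := subVg Pg Ptc; rewrite !invgM invgK mulgA.
apply: contraNT cyc => nr'; apply/eqP.
by rewrite {2}(cancel_uniq nr nr') inv_letterK.
Qed.

(** A shortest nontrivial word among all conjugates of elements of [P]. *)
Lemma cyclically_reduced_conjugate h : P h -> h <> 1 ->
  exists g c a u, [/\ fg_word c = a :: u, last a u != inv_letter a & P (g * c * g^-1)].
Proof.
move=> Ph h1.
have ex : exists n, `[<exists g c, [/\ P (g * c * g^-1), c <> 1 & size (fg_word c) = n]>].
  by exists (size (fg_word h)); apply/asboolP; exists 1, h; rewrite invg1 mulg1 mul1g.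
have [n /asboolP[g [c [Pc c1 cn]]] nmin] := ex_minnP ex.
case cau : (fg_word c) => [|a u]; first by case: c1; apply: fg_word_inj.
exists g, c, a, u; split=> //; apply/eqP => la.
case/lastP: u cau la => [|u b] cau; first by move=> /esym/eqP; rewrite inv_letter_neq.
rewrite last_rcons => ba; have rc := fg_reduced c; rewrite cau in rc.
have ru : reduced u.
  by move: rc => /reduced_behead; rewrite -cats1 => /reduced_catl.
have cE : c = letter a * FreeWord ru * (letter a)^-1.
  have rau : reduced (a :: u).
    by move: rc; rewrite -rcons_cons -cats1 => /reduced_catl.
  have auE : fg_word (letter a * FreeWord ru) = a :: u by rewrite fg_word_mul.
  by apply: fg_word_inj; rewrite letterV -ba fg_word_rcons auE ?cau.
suff /nmin : `[<exists g c, [/\ P (g * c * g^-1), c <> 1 & size (fg_word c) = size u]>].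
  by rewrite -cn cau /= size_rcons; lia.
apply/asboolP; exists (g * letter a), (FreeWord ru); split=> //.
  by rewrite invgM mulgA; move: Pc; rewrite cE !mulgA.
move=> /(congr1 (@fg_word _)) /= u0; move: rc; rewrite u0 ba /=.
by rewrite /reduced /= eqxx.
Qed.

(** Left multiplication by [m] moves a closed path to infinitely many cosets, whose
    representatives are prefixes of finitely many leaves. *)
Lemma normalized_finite_leaf_trivial n m : leaf P #<= `I_n ->
  (forall h, P h -> P (m * h * m^-1)) -> (forall k, P (m ^+ k.+1) -> False) ->
  forall h, P h -> h = 1.
Proof.
move=> /card_le_seqP[s _ Ls] mP mk h Ph; apply: contrapT => h1.
have [g [c [a [u [cau cyc Pc]]]]] := cyclically_reduced_conjugate Ph h1.
pose pre := [seq fg_take i w | w <- s, i <- iota 0 (size (fg_word w)).+1].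
have repP k : rep P (m ^+ k * g) \in pre.
  have Pk : P (m ^+ k * g * c * (m ^+ k * g)^-1).
    elim: k => [|k IHk]; first by rewrite expg0 mul1g.
    by have := mP _ IHk; rewrite expgS !invgM !mulgA.
  have [w Lw rw] := rep_leaf_prefix cau cyc Pk; rewrite Ls in Lw.
  apply/allpairsPdep; exists w, (size (fg_word (rep P (m ^+ k * g)))); split=> //.
    by rewrite mem_iota ltnS size_prefix.
  by rewrite fg_take_prefix.
suff : (size pre).+1 <= size pre by rewrite ltnn.
rewrite -card_le_II; apply: (@card_le_trans _ _ _ [set` pre]); last exact: card_le_mem.
apply: (@card_le_inj _ _ _ _ (fun k => rep P (m ^+ k * g))) => [k _|k l _ _ rkl].
  exact: repP.
have Pkl : P (m ^+ k * m ^- l).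
  have := coset_sym Pg (rep_coset Pg (m ^+ k * g)); rewrite rkl => /(coset_trans Pg).
  by move=> /(_ _ (rep_coset Pg (m ^+ l * g))); rewrite mulgKA.
case: (ltngtP k l) => // lt_kl; exfalso.
  apply: (mk (l - k).-1); rewrite prednK ?subn_gt0 // expgnFr ?(ltnW lt_kl) //.
  by have := subVg Pg Pkl; rewrite invgM invgK.
by apply: (mk (k - l).-1); rewrite prednK ?subn_gt0 // expgnFr ?(ltnW lt_kl).
Qed.

End NormalSubgroups.

(** * Cyclic subgroups and homomorphisms *)

Section IntegerPowers.
Variable G : groupType.
Implicit Types (g h : G) (K N : set G) (i j k : int).

Definition expgz g k : G :=
  match k with Posz n => g ^+ n | Negz n => g ^- n.+1 end.

Lemma expgzS g k : expgz g (k + 1)%R = expgz g k * g.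
Proof.
case: k => [n|n]; first by rewrite -PoszD addn1 /= expgSr.
case: n => [|n]; first by rewrite /= expg1 mulVg.
rewrite (_ : (Negz n.+1 + 1)%R = Negz n); last by lia.
by rewrite /= [g ^+ n.+2]expgS invgM mulgVK.
Qed.

Lemma expgzB1 g k : expgz g (k - 1)%R = expgz g k * g^-1.
Proof. by apply: (mulIg g); rewrite mulgVK -expgzS subrK. Qed.

Lemma expgzD g i j : expgz g (i + j)%R = expgz g i * expgz g j.
Proof.
elim/int_ind: j => [|n IHn|n IHn].
- by rewrite addr0 mulg1.
- by rewrite -addn1 PoszD addrA !expgzS IHn mulgA.
- by rewrite -addn1 PoszD opprD addrA !expgzB1 IHn mulgA.
Qed.

Lemma expgzN g k : expgz g (- k)%R = (expgz g k)^-1.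
Proof. by apply/esym/mulg1_eq; rewrite -expgzD subrr. Qed.

Lemma expgzM g i j : expgz g (i * j)%R = expgz (expgz g i) j.
Proof.
elim/int_ind: j => [|n IHn|n IHn]; first by rewrite mulr0.
- by rewrite -addn1 PoszD expgzS -IHn mulrDr mulr1 expgzD.
- by rewrite -addn1 PoszD opprD expgzB1 -IHn mulrDr mulrN1 expgzD expgzN.
Qed.

Lemma subXgz K g k : is_subgroup K -> K g -> K (expgz g k).
Proof.
by move=> Kg Kx; case: k => n; [|apply: subVg => //]; apply: subXg.
Qed.

Lemma mem_cycle g h : generated [set g] h -> exists k, h = expgz g k.
Proof.
move: h; apply: generated_sub => [|_ ->]; last by exists 1%R.
split=> [|_ _ [i ->] [j ->]|_ [i ->]]; first by exists 0%R.
  by exists (i + j)%R; rewrite expgzD.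
by exists (- i)%R; rewrite expgzN.
Qed.

End IntegerPowers.

(** Euclidean division by the least positive element. *)
Lemma int_subgroup (I : set int) : I 0%R ->
  (forall i j, I i -> I j -> I (i + j)%R) -> (forall i, I i -> I (- i)%R) ->
  exists2 d : int, I d & forall k, I k -> exists q, k = (d * q)%R.
Proof.
move=> I0 ID IN.
have [[n In]|none] := pselect (exists n, I (Posz n.+1)); last first.
  exists 0%R => // k Ik; exists 0%R; case: k Ik => [[|n]|n] Ik //.
    by case: none; exists n.
  by case: none; exists n; have := IN _ Ik; rewrite NegzE opprK.
have ex : exists n, `[<I (Posz n.+1)>] by exists n; apply/asboolP.
have [d /asboolP Id dmin] := ex_minnP ex.
have IM q : I (Posz d.+1 * q)%R.
  elim/int_ind: q => [|q IHq|q IHq]; first by rewrite mulr0.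
    by rewrite -[q.+1]addn1 PoszD mulrDr mulr1; apply: ID.
  by rewrite -[q.+1]addn1 PoszD opprD mulrDr mulrN1; apply: ID IHq (IN _ Id).
exists (Posz d.+1) => // k Ik; exists (k %/ Posz d.+1)%Z.
have Ir : I (k %% Posz d.+1)%Z.
  by rewrite /modz mulrC; apply: ID => //; apply: IN.
have r0 : (0 <= (k %% Posz d.+1)%Z)%R by rewrite modz_ge0.
have rd := @ltz_pmod k (Posz d.+1) isT.
have r_eq0 : (k %% Posz d.+1)%Z = 0%R.
  case er : (k %% Posz d.+1)%Z r0 rd Ir => [[|r]|r] //= _ rd /asboolP/dmin.
  by move: rd; lia.
by rewrite {1}(divz_eq k (Posz d.+1)) r_eq0 addr0 mulrC.
Qed.

Lemma sub_cycle (G : groupType) (N : set G) g : is_subgroup N ->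
  N `<=` generated [set g] -> exists h, N = generated [set h].
Proof.
move=> Ng Ngen; have [|||d Nd dN] := @int_subgroup [set k | N (expgz g k)].
- exact: (sub1g Ng).
- by move=> i j Ni Nj; rewrite /= expgzD; apply: subMg.
- by move=> i Ni; rewrite /= expgzN; apply: subVg.
exists (expgz g d); apply/esym/generatedP => // [_ ->//|h Nh].
have [k hk] := mem_cycle (Ngen _ Nh); rewrite hk in Nh *.
have [q ->] := dN k Nh; rewrite expgzM.
by apply: (subXgz q (generated_subgroup _)); apply: mem_generated.
Qed.

Lemma card_le1_sub (G : groupType) (S : set G) : S #<= `I_1 -> exists g, S `<=` [set g].
Proof.
move=> /card_le_seqP[[|g [|h s]] // _ ->]; first by exists 1.
by exists g => h; rewrite /= inE => /eqP.
Qed.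

Lemma card_set1_le (E : eqType) (e : E) : [set e] #<= `I_1.
Proof. by apply: (@card_le_mem _ _ [:: e]) => _ ->; rewrite /= inE. Qed.

Lemma card_set2_le (E : eqType) (e e' : E) : [set e; e'] #<= `I_2.
Proof.
by apply: (@card_le_mem _ _ [:: e; e']) => _ [|] ->; rewrite /= !inE eqxx ?orbT.
Qed.

Section Morphisms.
Variables (G G' : groupType) (f : {multiplicative G -> G'}).

Lemma group_morph1 : f 1 = 1.
Proof. by apply: (mulgI (f 1)); rewrite -gmulfM !mulg1. Qed.

Lemma group_morphV g : f g^-1 = (f g)^-1.
Proof. by apply/esym/mulg1_eq; rewrite -gmulfM mulgV group_morph1. Qed.

Lemma group_morph_expgz g k : f (expgz g k) = expgz (f g) k.
Proof.
elim/int_ind: k => [|n IHn|n IHn]; first by rewrite /= group_morph1.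
  by rewrite -addn1 PoszD !expgzS gmulfM IHn.
by rewrite -addn1 PoszD opprD !expgzB1 gmulfM group_morphV IHn.
Qed.

Lemma image_subgroup (K : set G) : is_subgroup K -> is_subgroup (f @` K).
Proof.
move=> Kg; split=> [|_ _ [g Kx <-] [h Ky <-]|_ [g Kx <-]].
- by exists 1; [exact: sub1g|rewrite group_morph1].
- by exists (g * h); [exact: subMg|rewrite gmulfM].
- by exists g^-1; [exact: subVg|rewrite group_morphV].
Qed.

Lemma image_generated (S : set G) : f @` generated S = generated (f @` S).
Proof.
apply/esym/generatedP; first exact/image_subgroup/generated_subgroup.
  by move=> _ [s Ss <-]; exists s => //; apply: mem_generated.
move=> _ [g Sg <-]; move: g Sg; apply: generated_sub => [|s Ss]; last first.
  by apply: mem_generated; exists s.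
have gS := generated_subgroup (f @` S).
by split=> [|g h Sg Sh|g Sg] /=; rewrite ?group_morph1 ?gmulfM ?group_morphV;
   [exact: (sub1g gS)|exact: (subMg gS)|exact: (subVg gS)].
Qed.

Lemma lift_generators (N : set G) (S : set G') n : is_subgroup N ->
  (forall g, N g -> f g = 1 -> g = 1) -> f @` N = generated S -> S #<= `I_n ->
  exists2 S', generated S' = N & S' #<= `I_n.
Proof.
move=> Ng inj fN Sn.
pose lift s := xget 1 [set g | N g /\ f g = s].
have liftP s : S s -> N (lift s) /\ f (lift s) = s.
  move=> /mem_generated; rewrite -fN => -[g Nx fg]; rewrite /lift.
  by case: xgetP => [h _ []//|/(_ g)[]].
exists (lift @` S); last exact: card_le_trans (card_image_le _ _) Sn.
apply: generatedP => // [_ [s /liftP[Ns _] <-]//|g Nx].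
have : (f @` generated (lift @` S)) (f g).
  rewrite image_generated (_ : f @` _ = S); first by rewrite -fN; exists g.
  rewrite image_comp; apply/seteqP; split=> [_ [s Ss <-]|s Ss] /=.
    by have [_ ->] := liftP s Ss.
  by exists s => //; have [_ ->] := liftP s Ss.
move=> [h Lh fh]; suff -> : g = h by [].
have Nh : N h.
  by move: h Lh {fh}; apply: generated_sub => // _ [s /liftP[Ns _] <-].
apply/divg1_eq/inj; first by apply: (subMg Ng) => //; apply: (subVg Ng).
by rewrite gmulfM group_morphV fh mulgV.
Qed.

End Morphisms.

(** * Intersections of subgroups of small rank *)

Section RankTwo.
Variable T : finType.
Local Notation F := (free_group T).
Local Notation Z := (Algebra.to_multiplicative int).
Local Notation FZ := (F * Z)%type.
Implicit Types (g h w : F) (K N : set FZ) (m n : int).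

Lemma expgz_central m k : expgz ((1, m) : FZ) k = (1, (m * k)%R).
Proof.
elim/int_ind: k => [|k IHk|k IHk]; first by rewrite mulr0.
  by rewrite -[k.+1]addn1 PoszD expgzS IHk mulrDr mulr1; congr pair; exact: mulg1.
rewrite -[k.+1]addn1 PoszD opprD expgzB1 IHk mulrDr mulrN1; congr pair.
exact: mulgV.
Qed.

Lemma expg_pair g m (k : nat) : ((g, m) : FZ) ^+ k = (g ^+ k, (m *+ k)%R).
Proof. by elim: k => [//|k IHk]; rewrite !expgS IHk mulrS. Qed.

(** An extension of a cyclic group by a cyclic group. *)
Lemma cyclic_projection_generators N g : is_subgroup N ->
  fst @` N `<=` generated [set g] -> exists2 S, generated S = N & S #<= `I_2.
Proof.
move=> Ng Ncyc.
have [h Nh] := sub_cycle (image_subgroup fst Ng) Ncyc.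
have [k Nk kh] : (fst @` N) h by rewrite Nh; apply: mem_generated.
have [|||d Nd dN] := @int_subgroup [set m | N (1, m)].
- exact: (sub1g Ng).
- move=> i j Ni Nj; have := subMg Ng Ni Nj.
  by rewrite (_ : _ * _ = (1, (i + j)%R) :> FZ) //; congr pair; exact: mulg1.
- move=> i Ni; have := subVg Ng Ni.
  by rewrite (_ : _^-1 = (1, (- i)%R) :> FZ) //; congr pair; exact: invg1.
have {}Nd : N (1, d) := Nd.
pose S : set FZ := [set k; (1, d)]; have gS := generated_subgroup S.
exists S; last exact: card_set2_le.
apply: generatedP => // [_ [->|->] //|z Nz].
have : (fst @` N) z.1 by exists z.
rewrite Nh => /mem_cycle[i zi].
pose c := z * (expgz k i)^-1.
have Nc : N c by apply: (subMg Ng) => //; apply/(subVg Ng)/(subXgz i Ng).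
have c1 : c.1 = 1.
  have e : (expgz k i).1 = expgz k.1 i := group_morph_expgz (@fst F Z) k i.
  by rewrite -[LHS]/(z.1 * (expgz k i).1^-1) e kh zi mulgV.
have zE : c * expgz k i = z := mulgVK (expgz k i) z.
rewrite -zE; apply: (subMg gS).
  case: c c1 Nc {zE} => w m /= -> Nm; have [q ->] := dN m Nm.
  by rewrite -expgz_central; apply: (subXgz q gS); apply: mem_generated; right.
by apply: (subXgz i gS); apply: mem_generated; left.
Qed.

Lemma pos_leaf1_cycle (A : set F) :
  is_subgroup A -> pos_leaf A #<= `I_1 -> exists g, A `<=` generated [set g].
Proof.
move=> Ag A1; have [g sub] := card_le1_sub (card_le_trans (card_image_le (schreier_gen A) _) A1).
exists g; rewrite -{1}(schreier_generated Ag).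
by apply: generated_sub; [exact: generated_subgroup|move=> z /sub/mem_generated].
Qed.

Lemma leaf_pos_card (A : set F) (n : nat) : leaf A #<= `I_n -> pos_leaf A #<= `I_n.
Proof. by apply: card_le_trans; apply: subset_card_le => w /pos_leaf_leaf. Qed.

Lemma proj_pos_leaf K S (n : nat) : generated S = K -> S #<= `I_n -> pos_leaf (fst @` K) #<= `I_n.
Proof.
move=> SK Sn; have Kg : is_subgroup K by rewrite -SK; apply: generated_subgroup.
apply: (@pos_leaf_card _ _ (image_subgroup fst Kg) (fst @` S)).
  by rewrite -SK (image_generated fst).
exact: card_le_trans (card_image_le _ _) Sn.
Qed.

(** A nontrivial element of the centre leaves room for only one edge outside of
    the spanning tree of the projection. *)
Lemma rank2_dichotomy K S : generated S = K -> S #<= `I_2 ->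
  (forall k, K k -> k.1 = 1 -> k = 1) \/ exists g, fst @` K `<=` generated [set g].
Proof.
move=> SK S2; have Kg : is_subgroup K by rewrite -SK; apply: generated_subgroup.
have [inj|/existsNP[[g m]]] := pselect (forall k, K k -> k.1 = 1 -> k = 1); first by left.
move=> /not_implyP[Km /not_implyP[/= g1 km]]; right.
rewrite {}g1 in Km km.
have m0 : m <> 0%R by move=> m0; apply: km; rewrite m0.
apply: pos_leaf1_cycle; first exact: (image_subgroup fst Kg).
exact: (pos_leaf_card_central (image_subgroup fst Kg) SK S2 erefl Km m0).
Qed.

(** On [A], the intersection of the projections, the two lifts differ by a
    homomorphism to the integers. If it vanishes, the intersection of the lifts
    is as large as [A], whose rank is bounded; otherwise the intersection projects
    to a normal subgroup of infinite index of [A], hence it is infinitely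
    generated or trivial. *)
Lemma rank2_injective K1 K2 S1 S2 r :
  generated S1 = K1 -> generated S2 = K2 -> S1 #<= `I_2 -> S2 #<= `I_2 ->
  (forall k, K1 k -> k.1 = 1 -> k = 1) -> (forall k, K2 k -> k.1 = 1 -> k = 1) ->
  has_rank (K1 `&` K2) r -> (r <= 258 * #|{: T * bool}|)%N.
Proof.
move=> SK1 SK2 S12 S22 inj1 inj2 rN.
have K1g : is_subgroup K1 by rewrite -SK1; apply: generated_subgroup.
have K2g : is_subgroup K2 by rewrite -SK2; apply: generated_subgroup.
have Ng := subgroupI K1g K2g.
have injN k : (K1 `&` K2) k -> k.1 = 1 -> k = 1 by move=> [/inj1].
have A1g := image_subgroup fst K1g; have A2g := image_subgroup fst K2g.
have Ag := subgroupI A1g A2g.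
have [same|] := pselect (forall g m n, K1 (g, m) -> K2 (g, n) -> m = n).
  have NA : fst @` (K1 `&` K2) = (fst @` K1) `&` (fst @` K2).
    apply/seteqP; split=> [_ [k [K1k K2k] <-]|g [[[g1 m] K1m /= e1] [[g2 n] K2n /= e2]]].
      by split; exists k.
    rewrite e1 in K1m; rewrite e2 in K2n; exists (g, m) => //; split=> //.
    by rewrite (same _ _ _ K1m K2n).
  (* Two generators give 2 + 2 leaves, hence 4 * 4 branch vertices, so that the
     intersection has at most 16 * 16 + 1 of them. *)
  have B1 := branch_card (leaf_card A1g (proj_pos_leaf SK1 S12)).
  have B2 := branch_card (leaf_card A2g (proj_pos_leaf SK2 S22)).
  have L := leaf_pos_card (leaf_card_branch Ag (branchI_card A1g A2g B1 B2)).
  have gen : fst @` (K1 `&` K2) = generated (schreier_gen (fst @` K1 `&` fst @` K2)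
                                     @` pos_leaf (fst @` K1 `&` fst @` K2)).
    by rewrite schreier_generated.
  have [S SN Sn] := lift_generators Ng injN gen (card_le_trans (card_image_le _ _) L).
  exact: has_rank_leq rN SN Sn.
move=> /existsNP[g] /existsNP[m] /existsNP[n] /not_implyP[K1m] /not_implyP[K2n mn].
have [S SN Sr] := has_rank_gens rN.
have Pg := image_subgroup fst Ng.
have triv := normalized_finite_leaf_trivial Pg (leaf_card Pg (proj_pos_leaf SN Sr)).
suff N1 : K1 `&` K2 `<=` [set 1].
  apply: (leq_trans _ (leq0n _)); apply: (has_rank_leq rN _ (card_ge0 _ _)).
  apply: generatedP => // k /N1 ->; exact: (sub1g (generated_subgroup _)).
move=> k Nk; apply: (injN _ Nk); apply: (triv g) => [_ [z [K1z K2z] <-]|j|]; last by exists k.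
  pose gm : FZ := (g, m); pose gn : FZ := (g, n).
  exists (gm * z * gm^-1) => //; split.
    by apply: (subMg K1g); [exact: (subMg K1g)|exact: (subVg K1g)].
  have -> : gm * z * gm^-1 = gn * z * gn^-1.
    by congr pair; rewrite -[LHS]/(m + z.2 - m)%R -[RHS]/(n + z.2 - n)%R; lia.
  by apply: (subMg K2g); [exact: (subMg K2g)|exact: (subVg K2g)].
move=> [z [K1z K2z] zg].
have powE (K : set FZ) (i : int) : is_subgroup K -> (forall k, K k -> k.1 = 1 -> k = 1) ->
    K z -> K (g, i) -> z.2 = (i *+ j.+1)%R :> Z.
  move=> Kg injK Kz Ki; have := subXg Kg j.+1 Ki; rewrite expg_pair => Kij.
  suff -> : z = (g ^+ j.+1, (i *+ j.+1)%R) by [].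
  apply/divg1_eq/injK; first by apply: (subMg Kg) => //; apply: (subVg Kg).
  by rewrite -[LHS]/(z.1 * (g ^+ j.+1)^-1) zg mulgV.
have := powE _ _ K1g inj1 K1z K1m; rewrite (powE _ _ K2g inj2 K2z K2n) => e.
exact/mn/esym/(@pmulrnI int j.+1 isT _ _ e).
Qed.

Lemma rank2_bounded K1 K2 S1 S2 r :
  generated S1 = K1 -> generated S2 = K2 -> S1 #<= `I_2 -> S2 #<= `I_2 ->
  has_rank (K1 `&` K2) r -> (r <= 258 * #|{: T * bool}| + 2)%N.
Proof.
move=> SK1 SK2 S12 S22 rN.
have K1g : is_subgroup K1 by rewrite -SK1; apply: generated_subgroup.
have K2g : is_subgroup K2 by rewrite -SK2; apply: generated_subgroup.
have Ng := subgroupI K1g K2g.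
have cyclic g : fst @` (K1 `&` K2) `<=` generated [set g] ->
    (r <= 258 * #|{: T * bool}| + 2)%N.
  move=> /(cyclic_projection_generators Ng)[S SN S2'].
  by rewrite (leq_trans (has_rank_leq rN SN S2')) ?leq_addl.
have [inj1|[g cyc1]] := rank2_dichotomy SK1 S12; last first.
  by apply: (cyclic g) => _ [k [K1k _] <-]; apply: cyc1; exists k.
have [inj2|[g cyc2]] := rank2_dichotomy SK2 S22; last first.
  by apply: (cyclic g) => _ [k [_ K2k] <-]; apply: cyc2; exists k.
by rewrite (leq_trans (rank2_injective SK1 SK2 S12 S22 inj1 inj2 rN)) ?leq_addr.
Qed.

End RankTwo.

Lemma rank1_bounded (G : groupType) (K1 K2 S : set G) r :
  is_subgroup K2 -> generated S = K1 -> S #<= `I_1 ->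
  has_rank (K1 `&` K2) r -> (r <= 1)%N.
Proof.
move=> K2g SK1 S1 rN.
have K1g : is_subgroup K1 by rewrite -SK1; apply: generated_subgroup.
have [g Sg] := card_le1_sub S1.
have K1c : K1 `<=` generated [set g].
  rewrite -SK1; apply: generated_sub; first exact: generated_subgroup.
  by move=> s /Sg/mem_generated.
have [|h Nh] := sub_cycle (subgroupI K1g K2g) (g := g); first by move=> k [/K1c].
exact: has_rank_leq rN (esym Nh) (card_set1_le h).
Qed.

Lemma bounded_rank_sum a b : (a + b < 5)%N ->
  exists N : nat, forall (K1 K2 : set F2xZ) (r : nat),
    is_subgroup K1 -> is_subgroup K2 ->
    has_rank K1 a -> has_rank K2 b -> has_rank (K1 `&` K2) r -> (r <= N)%N.
Proof.
move=> ab; exists (258 * #|{: bool * bool}| + 2)%N => K1 K2 r K1g K2g.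
move=> /has_rank_gens[S1 SK1 S1a] /has_rank_gens[S2 SK2 S2b] rN.
have widen (S : set F2xZ) i j : (i <= j)%N -> S #<= `I_i -> S #<= `I_j.
  by move=> le_ij /card_le_trans; apply; rewrite card_le_II.
case: (leqP a 1) => [a1|a2].
  by rewrite (leq_trans (rank1_bounded K2g SK1 (widen _ _ _ a1 S1a) rN)) // addn2.
case: (leqP b 1) => [b1|b2].
  rewrite setIC in rN.
  by rewrite (leq_trans (rank1_bounded K1g SK2 (widen _ _ _ b1 S2b) rN)) // addn2.
have [a_le2 b_le2] : (a <= 2)%N /\ (b <= 2)%N by lia.
exact: (rank2_bounded SK1 SK2 (widen _ _ _ a_le2 S1a) (widen _ _ _ b_le2 S2b) rN).
Qed.

(** * Subgroups whose intersection has large rank *)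

Section Example.

Definition exponent_step (c : bool) (a : bool * bool) (n : int) : int :=
  if a.1 == c then (if a.2 then n - 1 else n + 1)%R else n.

Lemma exponent_stepK c a : cancel (exponent_step c a) (exponent_step c (inv_letter a)).
Proof. by case: a c => [[] []] [] n; rewrite /exponent_step /=; lia. Qed.

(** The exponent sum of a generator of the free group. *)
Definition exponent c (g : F2) : int := act (exponent_step c) 0%R g.

Lemma exponentM c (g h : F2) : exponent c (g * h) = (exponent c g + exponent c h)%R.
Proof.
have shift n (k : F2) : act (exponent_step c) n k = (n + exponent c k)%R.
  rewrite /exponent; elim/free_group_ind: k => [|k a r IHk]; first by rewrite addr0.
  rewrite !(actM (exponent_stepK c)) IHk !act_letter /exponent_step.
  by case: ifP => // _; case: ifP => // _; lia.
by rewrite {1}/exponent (actM (exponent_stepK c)) shift.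
Qed.

Lemma pair_eqP (g h : F2xZ) : fg_word g.1 = fg_word h.1 -> g.2 = h.2 -> g = h.
Proof. by case: g h => [g m] [h n] /= /fg_word_inj-> ->. Qed.

Lemma expg_t n : t ^+ n = (1, Posz n).
Proof. by rewrite /t expg_pair expg1n; congr pair; rewrite -mulr_natr mul1r natz. Qed.

Lemma t_central n (g : F2xZ) : commute g (t ^+ n).
Proof.
rewrite expg_t /commute; case: g => g m; congr pair; first by rewrite /= mulg1 mul1g.
exact: addrC.
Qed.

Lemma conj_central (G : groupType) (v c u : G) :
  commute u c -> (v * c) * u * (v * c)^-1 = v * u * v^-1.
Proof. by move=> uc; rewrite -(mulgA v) -uc invgM !mulgA mulgK. Qed.

Lemma conj_mul (G : groupType) (q v u : G) :
  (q * v) * u * (q * v)^-1 = q * (v * u * v^-1) * q^-1.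
Proof. by rewrite invgM !mulgA. Qed.

(** [U] belongs to both subgroups, whereas [V] belongs to the second one and
    [V * t ^+ 6] to the first one. *)
Definition U : F2xZ := x ^+ 6 * t ^+ 12.
Definition V : F2xZ := y * x ^+ 3 * y^-1.

Section FixedIndex.
Variable p : nat.
Hypothesis p_gt0 : (1 <= p)%N.

Let H1 := generated [set x ^+ 3 * t ^+ 6; y * x; t ^+ (6 * p)%N].
Let H2 := generated [set x ^+ 2 * t ^+ 4; y * x * y^-1].

Lemma H1_rank : has_rank H1 3.
Proof.
pose g (i : 'I_3) : F2xZ := nth 1 [:: y * x; x ^+ 3 * t ^+ 6; t ^+ (6 * p)] i.
pose phi (i : 'I_3) (h : F2xZ) : int :=
  nth 0%R [:: exponent true h.1; exponent false h.1; h.2 : int] i.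
apply: (@has_rank_intro _ H1 _ 3 g phi erefl).
- apply: (@card_le_mem _ _ [:: x ^+ 3 * t ^+ 6; y * x; t ^+ (6 * p)]).
  by move=> _ [[|]|] ->; rewrite /= !inE eqxx ?orbT.
- by move=> [[|[|[|i]]] //= lt_i3] h k _ _; rewrite /phi /= ?exponentM.
- by move=> [[|[|[|i]]] //= lt_i3]; apply: mem_generated; rewrite /g /=;
    [left; right|left; left|right].
- move=> [[|[|[|i]]] //= lt_i3] [[|[|[|j]]] //= lt_j3] _ //;
  by rewrite /phi /g /= ?expg_t //.
- move=> [[|[|[|i]]] //= lt_i3]; rewrite /phi /g /= ?expg_t //=; lia.
Qed.

Lemma H2_rank : has_rank H2 2.
Proof.
pose g (i : 'I_2) : F2xZ := nth 1 [:: x ^+ 2 * t ^+ 4; y * x * y^-1] i.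
pose phi (i : 'I_2) (h : F2xZ) : int := nth 0%R [:: h.2 : int; exponent false h.1] i.
apply: (@has_rank_intro _ H2 _ 2 g phi erefl).
- exact: card_set2_le.
- by move=> [[|[|i]] //= lt_i2] h k _ _; rewrite /phi /= ?exponentM.
- by move=> [[|[|i]] //= lt_i2]; apply: mem_generated; rewrite /g /=; [left|right].
- by move=> [[|[|i]] //= lt_i2] [[|[|j]] //= lt_j2] _.
- by move=> [[|[|i]] //= lt_i2].
Qed.

(* Generated by the Schreier generators of the subgroup of [<U, V>] on which the
   exponent sum of [V] is a multiple of [p]. *)
Let K := generated ([set V ^+ p] `|` [set V ^+ i * U * V ^- i | i in `I_p]).

Let H1g : is_subgroup H1. Proof. exact: generated_subgroup. Qed.
Let H2g : is_subgroup H2. Proof. exact: generated_subgroup. Qed.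
Let Kg : is_subgroup K. Proof. exact: generated_subgroup. Qed.

Lemma K_sub_intersection : K `<=` H1 `&` H2.
Proof.
have H1a : H1 (x ^+ 3 * t ^+ 6) by apply: mem_generated; left; left.
have H1b : H1 (y * x) by apply: mem_generated; left; right.
have H1c : H1 (t ^+ (6 * p)) by apply: mem_generated; right.
have H2c : H2 (x ^+ 2 * t ^+ 4) by apply: mem_generated; left.
have H2d : H2 (y * x * y^-1) by apply: mem_generated; right.
have U1 : H1 U.
  by rewrite (_ : U = (x ^+ 3 * t ^+ 6) ^+ 2); [exact: (subXg H1g)|exact: pair_eqP].
have U2 : H2 U.
  by rewrite (_ : U = (x ^+ 2 * t ^+ 4) ^+ 3); [exact: (subXg H2g)|exact: pair_eqP].
have V2 : H2 V by rewrite (_ : V = (y * x * y^-1) ^+ 3); [exact: (subXg H2g)|exact: pair_eqP].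
have Vt1 : H1 (V * t ^+ 6).
  rewrite (_ : _ * _ = (y * x) * (x ^+ 3 * t ^+ 6) * (y * x)^-1); last exact: pair_eqP.
  by apply: (subMg H1g); [exact: (subMg H1g)|exact: (subVg H1g)].
have VtX n : (V * t ^+ 6) ^+ n = V ^+ n * t ^+ (6 * n).
  by rewrite expgMn ?expgnA //; apply: t_central.
apply: generated_sub; first exact: subgroupI.
move=> _ [->|[i _ <-]]; split.
- apply: (subMgr H1g H1c); rewrite -VtX; exact: (subXg H1g).
- exact: (subXg H2g).
- have -> : V ^+ i * U * V ^- i = (V * t ^+ 6) ^+ i * U * (V * t ^+ 6) ^- i.
    by rewrite VtX conj_central //; apply: t_central.
  by apply: (subMg H1g); [apply: (subMg H1g) => //|apply: (subVg H1g)]; apply: (subXg H1g).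
- by apply: (subMg H2g); [apply: (subMg H2g) => //|apply: (subVg H2g)]; apply: (subXg H2g).
Qed.

(** Modulo the power [V ^+ p], the exponent can be taken in the range from 0 to
    [p - 1]. *)
Lemma K_conjugate j : K (expgz V j * U * (expgz V j)^-1).
Proof.
have Vp : K (V ^+ p) by apply: mem_generated; left.
have p0 : Posz p != 0%R by lia.
have r0 := modz_ge0 j p0; have := ltz_pmod j (p_gt0 : (0 < Posz p)%R).
case rj : (j %% Posz p)%Z r0 => [i|//] _ lt_ip.
have -> : expgz V j = expgz (V ^+ p) (j %/ p)%Z * V ^+ i.
  rewrite -[V ^+ p]/(expgz V (Posz p)) -expgzM -[V ^+ i]/(expgz V (Posz i)) -expgzD.
  by rewrite -rj mulrC -divz_eq.
set q := expgz _ _; have Kq : K q by apply: (subXgz _ Kg).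
rewrite conj_mul; apply: (subMg Kg); last exact: (subVg Kg).
by apply: (subMg Kg) => //; apply: mem_generated; right; exists i.
Qed.

Lemma expgz_conj (g h : F2xZ) j : expgz (g * h * g^-1) j = g * expgz h j * g^-1.
Proof.
elim/int_ind: j => [|n IHn|n IHn]; first by rewrite /= mulg1 mulgV.
  by rewrite -[n.+1]addn1 PoszD !expgzS IHn !mulgA mulgVK.
rewrite -[n.+1]addn1 PoszD opprD !expgzB1 IHn !invgM invgK !mulgA mulgVK.
by rewrite -!mulgA.
Qed.

Lemma K_conjugateX j k : K (expgz V j * expgz U k * (expgz V j)^-1).
Proof. by rewrite -expgz_conj; apply: (subXgz _ Kg); apply: K_conjugate. Qed.

(** Reading a word in the Stallings graph of the projection of the first
    subgroup, a triangle of [x]-edges with a [y]-edge joining two of its vertices,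
    the state is half of the exponent of [t], up to multiples of [3 * p]; its class
    modulo 3 is the vertex. *)
Definition step1 (a : bool * bool) (k : int) : option int :=
  match a with
  | (false, false) => Some (k + 1)%R
  | (false, true) => Some (k - 1)%R
  | (true, false) => if (3 %| k)%Z then Some (k - 1)%R else None
  | (true, true) => if (3 %| (k + 1)%R)%Z then Some (k + 1)%R else None
  end.

(** The Stallings graph of the projection of the second subgroup has a cycle of
    two [x]-edges and a [y]-edge to a vertex bearing an [x]-loop. The boolean
    tells whether that vertex has been reached, the integer is again half of the
    exponent of [t]. *)
Definition step2 (a : bool * bool) (s : int * bool) : option (int * bool) :=
  let: (k, b) := s in
  match a with
  | (false, false) => Some ((if b then k else k + 1)%R, b)
  | (false, true) => Some ((if b then k else k - 1)%R, b)
  | (true, e) => if (b == e) && (2 %| k)%Z then Some (k, ~~ b) else None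
  end.

Lemma step1V a k l : step1 a k = Some l -> step1 (inv_letter a) l = Some k.
Proof.
case: a => [[] []] /=; first case: ifP => // d3; last first.
- by move=> [<-]; congr Some; lia.
- by move=> [<-]; congr Some; lia.
- by case: ifP => // d3 [<-]; rewrite subrK d3.
- by move=> [<-]; rewrite (_ : (_ - 1 = k)%R) ?d3 //; lia.
Qed.

Lemma step2V a s s' : step2 a s = Some s' -> step2 (inv_letter a) s' = Some s.
Proof.
case: a s => [[] []] [k b] /=; last first.
- by move=> [<-]; case: b; congr (Some (_, _)); lia.
- by move=> [<-]; case: b; congr (Some (_, _)); lia.
- by case: b => //=; case: ifP => // d2 [<-]; rewrite /= d2.
- by case: b => //=; case: ifP => // d2 [<-]; rewrite /= d2.
Qed.

Lemma run1_shift d w k l : (3 %| d)%Z ->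
  run step1 w k = Some l -> run step1 w (k + d)%R = Some (l + d)%R.
Proof.
move=> d3; elim: w k => [|a w IHw] k; first by move=> [->].
rewrite !run_cons; case ak: (step1 a k) => [k'|] // /IHw; suff -> : step1 a (k + d)%R = Some (k' + d)%R by [].
case: a ak => [[] []] /=; try (by move=> [<-]; congr Some; lia).
- case: ifP => // e3 [<-]; rewrite (_ : (3 %| (k + d + 1)%R)%Z); first by congr Some; lia.
  by lia.
- case: ifP => // e3 [<-]; rewrite (_ : (3 %| (k + d)%R)%Z); first by congr Some; lia.
  by lia.
Qed.

Lemma run2_shift d w k b l c : (2 %| d)%Z ->
  run step2 w (k, b) = Some (l, c) -> run step2 w ((k + d)%R, b) = Some ((l + d)%R, c).
Proof.
move=> d2; elim: w k b => [|a w IHw] k b; first by move=> [-> ->].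
rewrite !run_cons; case ak: (step2 a (k, b)) => [[k' b']|] // /IHw.
suff -> : step2 a ((k + d)%R, b) = Some ((k' + d)%R, b') by [].
case: a ak => [[] e] /=.
  case: eqP => //= _; case: ifP => // e2 [<- <-].
  by rewrite (_ : (2 %| (k + d)%R)%Z) //; lia.
by case: e b => [] [] [<- <-]; congr (Some (_, _)); lia.
Qed.

Lemma H1_run (g : F2xZ) : H1 g ->
  exists k q, [/\ run step1 g.1 0%R = Some k, (3 %| k)%Z & g.2 = (2 * k + (6 * Posz p) * q : int)%R].
Proof.
move: g; apply: generated_sub; last first.
  move=> _ [[|]|] ->.
  - by exists 3%R, 0%R; split=> //; rewrite !mulr0.
  - by exists 0%R, 0%R; split=> //; rewrite !mulr0.
  - by exists 0%R, 1%R; rewrite expg_t; split=> //=; lia.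
split.
- by exists 0%R, 0%R; split=> //; rewrite !mulr0.
- move=> g h [k [q [gk k3 gq]]] [l [r [hl l3 hr]]].
  exists (l + k)%R, (q + r)%R; split; last 1 first.
  + by rewrite -[LHS]/(g.2 + h.2)%R gq hr; lia.
  + apply: (run_mul step1V gk); rewrite -[X in run _ _ X]add0r.
    exact: run1_shift.
  + by lia.
- move=> g [k [q [gk k3 gq]]]; exists (- k)%R, (- q)%R; split.
  + rewrite -[X in Some X]add0r -[X in run _ _ X](subrr k); apply: run1_shift; first lia.
    exact: (run_inv step1V gk).
  + by lia.
  + by rewrite -[LHS]/(- g.2)%R gq; lia.
Qed.

Lemma H2_run (g : F2xZ) : H2 g ->
  exists k, [/\ run step2 g.1 (0%R, false) = Some (k, false), (2 %| k)%Z & g.2 = (2 * k : int)%R].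
Proof.
move: g; apply: generated_sub; last first.
  by move=> _ [|] ->; [exists 2%R|exists 0%R].
split.
- by exists 0%R.
- move=> g h [k [gk k2 gq]] [l [hl l2 hr]]; exists (l + k)%R; split.
  + apply: (run_mul step2V gk); rewrite -[X in run _ _ (X, _)]add0r.
    exact: run2_shift.
  + by lia.
  + by rewrite -[LHS]/(g.2 + h.2)%R gq hr; lia.
- move=> g [k [gk k2 gq]]; exists (- k)%R; split.
  + rewrite -[X in Some (X, _)]add0r -[X in run _ _ (X, _)](subrr k).
    by apply: run2_shift; [lia|exact: (run_inv step2V gk)].
  + by lia.
  + by rewrite -[LHS]/(- g.2)%R gq; lia.
Qed.

(** The words read by both graphs follow, up to an element of [K], a power of
    [V] and then either a path along the hexagon of [x]-edges of the product
    graph or, after a [y]-edge, along its triangle. *)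
Lemma run_both (g : F2) k1 k2 b :
  run step1 g 0%R = Some k1 -> run step2 g (0%R, false) = Some (k2, b) ->
  exists h j k, K h /\
    if b then
      [/\ (g, (2 * k2)%R) = h * expgz V j * y * expgz x k,
          k1 = (k2 + 3 * j + k - 1)%R & (6 %| k2)%Z]
    else
      [/\ (g, (2 * k2)%R) = h * expgz V j * expgz (x * t ^+ 2) k,
          k1 = (k2 + 3 * j)%R & (6 %| (k2 - k)%R)%Z].
Proof.
elim/free_group_ind: g k1 k2 b => [|g a r IHg] k1 k2 b.
  move=> [<-] [<- <-]; exists 1, 0%R, 0%R; split; first exact: (sub1g Kg).
  by split=> //; apply: pair_eqP.
rewrite fg_word_rcons // !run_rcons.
case e1: (run step1 g 0%R) => [l1|] //=; case e2: (run step2 g _) => [[l2 c]|] //=.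
have [h [j [k [Kh]]]] := IHg _ _ _ e1 e2.
have mulE (b' : bool) (m n : int) :
    (g * letter (b', false), (m + n)%R) = ((g, m) : F2xZ) * (letter (b', false), n).
  by [].
have mulEV (b' : bool) (m n : int) :
    (g * letter (b', true), (m - n)%R) = ((g, m) : F2xZ) * ((letter (b', false), n) : F2xZ)^-1.
  by congr pair; rewrite /= letterV.
have xE : x = (letter (false, false), 0%R) by exact: pair_eqP.
have yE : y = (letter (true, false), 0%R) by exact: pair_eqP.
have xtE : x * t ^+ 2 = (letter (false, false), Posz 2) by exact: pair_eqP.
case: a c {r e1 e2 IHg} => [[] []] [] //= [gE l1E l2E].
- case: ifP => // d3 [<-]; case: ifP => // d2 [<- <-]; pose m := (k %/ 3)%Z.
  have km : k = (3 * m)%R by rewrite /m; lia.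
  exists h, (j + m)%R, 0%R; split=> //; split; [|by lia|by lia].
  have Vm : y * expgz x k * y^-1 = expgz V m by rewrite km expgzM /V expgz_conj.
  rewrite -(subr0 (2 * _)%R) mulEV -yE gE expgzD -Vm mulg1.
  move: (expgz V j) (expgz x k) => v xk; by rewrite !mulgA.
- case: ifP => // d3 [<-]; case: ifP => // d2 [<- <-]; pose m := (k %/ 6)%Z.
  have km : k = (6 * m)%R by rewrite /m; lia.
  exists (h * (expgz V j * expgz U m * (expgz V j)^-1)), j, 0%R; split.
    by apply: (subMg Kg) => //; apply: K_conjugateX.
  split; [|by lia|by lia].
  rewrite -(addr0 (2 * _)%R) mulE -yE gE km expgzM.
  rewrite (_ : expgz (x * t ^+ 2) 6 = U); last exact: pair_eqP.
  by move: (expgz V j) (expgz U m) => v u; rewrite mulg1 !mulgA mulgVK.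
- move=> [<-] [<- <-]; exists h, j, (k - 1)%R; split=> //; split; [|by lia|by lia].
  by rewrite -(subr0 (2 * _)%R) mulEV -xE gE expgzB1 !mulgA.
- move=> [<-] [<- <-]; exists h, j, (k - 1)%R; split=> //; split; [|by lia|by lia].
  rewrite (_ : (2 * (l2 - 1))%R = (2 * l2 - 2)%R); last by lia.
  by rewrite mulEV -xtE gE expgzB1 !mulgA.
- move=> [<-] [<- <-]; exists h, j, (k + 1)%R; split=> //; split; [|by lia|by lia].
  by rewrite -(addr0 (2 * _)%R) mulE -xE gE expgzS !mulgA.
- move=> [<-] [<- <-]; exists h, j, (k + 1)%R; split=> //; split; [|by lia|by lia].
  rewrite (_ : (2 * (l2 + 1))%R = (2 * l2 + 2)%R); last by lia.
  by rewrite mulE -xtE gE expgzS !mulgA.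
Qed.

Lemma intersectionE : H1 `&` H2 = K.
Proof.
apply/seteqP; split; last exact: K_sub_intersection.
move=> [g n] [/H1_run[k1 [q [r1 d1 n1]]] /H2_run[k2 [r2 d2 n2]]].
have [h [j [k [Kh]]]] := run_both r1 r2; rewrite /= in n1 n2 *; rewrite {}n2 in n1 *.
move=> [-> k1E d6]; pose m := (k %/ 6)%Z.
have km : k = (6 * m)%R by rewrite /m; lia.
have jE : j = (Posz p * - q)%R by lia.
rewrite jE km expgzM (expgzM _ 6) (_ : expgz (x * t ^+ 2) 6 = U); last exact: pair_eqP.
have KV : K (V ^+ p) by apply: mem_generated; left.
have KU : K U by have := K_conjugate 0; rewrite /= invg1 mulg1 mul1g.
by apply: (subMg Kg); [apply: (subMg Kg) => //|]; apply: (subXgz _ Kg).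
Qed.
(** The first vertices of this covering of the bouquet carry [x]-loops, the
    second ones form a line of [x]-edges, and the two are matched by [y]: so [V]
    shifts the first vertices by 3, and the last component counts the passages
    through the loops at the vertices congruent to [3 * i] modulo [3 * p]. *)
Definition loop_at (i : nat) (j : int) : bool := (3 * Posz p %| (j - 3 * Posz i)%R)%Z.

Definition step3 (i : nat) (a : bool * bool) (s : bool * int * int) : bool * int * int :=
  let: (b, j, c) := s in
  let d : int := if a.2 then (-1)%R else 1%R in
  if a.1 then (~~ b, j, c)
  else if b then (b, (j + d)%R, c) else (b, j, (c + d * (loop_at i j)%:Z)%R).

Lemma step3K i a : cancel (step3 i a) (step3 i (inv_letter a)).
Proof.
case: a => [[] e] [[b j] c]; rewrite /step3 /= ?negbK //.
by case: b e => [] [] /=; congr (_, _, _); lia.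
Qed.

Lemma act3M i s (g h : F2xZ) :
  act (step3 i) s (g * h).1 = act (step3 i) (act (step3 i) s g.1) h.1.
Proof. exact: (actM (step3K i)). Qed.

Let s0 : bool * int * int := (false, 0%R, 0%R).

(** The shifts by multiples of [3 * p] are deck transformations. *)
Lemma act3_shift i g (b b' : bool) (j j' c c' d e : int) :
  act (step3 i) (b, j, c) g = (b', j', c') ->
  act (step3 i) (b, (j + 3 * Posz p * d)%R, (c + e)%R) g
    = (b', (j' + 3 * Posz p * d)%R, (c' + e)%R).
Proof.
elim/free_group_ind: g b' j' c' => [|g a r IHg] b' j' c'; first by move=> [<- <- <-].
rewrite !(actM (step3K i)) !act_letter.
case eg: (act _ (b, j, c) g) => [[b1 j1] c1]; rewrite (IHg _ _ _ eg).
have loop_shift : loop_at i (j1 + 3 * Posz p * d)%R = loop_at i j1.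
  rewrite /loop_at (_ : (j1 + 3 * Posz p * d - 3 * Posz i = j1 - 3 * Posz i + 3 * Posz p * d)%R).
    by rewrite rpredDr // dvdz_mulr ?dvdzz.
  by lia.
rewrite /step3 loop_shift.
case: ifP => _; first by move=> [<- <- <-].
by case: b1 {eg} => -[<- <- <-]; congr (_, _, _); ring.
Qed.

Lemma act3_V i j c n :
  act (step3 i) (false, j, c) (V ^+ n).1 = (false, (j + 3 * Posz n)%R, c).
Proof.
elim: n => [|n IHn]; first by rewrite mulr0 addr0.
rewrite expgSr act3M IHn /act [fg_word _]/= /=.
by congr (_, _, _); lia.
Qed.

Lemma act3_U i j c :
  act (step3 i) (false, j, c) U.1 = (false, j, (c + 6 * (loop_at i j)%:Z)%R).
Proof. by rewrite /act [fg_word _]/= /=; congr (_, _, _); lia. Qed.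

Lemma act3_conjugate i n :
  act (step3 i) s0 (V ^+ n * U * V ^- n).1 = (false, 0%R, (6 * (loop_at i (3 * Posz n))%:Z)%R).
Proof.
rewrite (act3M _ _ (V ^+ n * U)) (act3M _ _ (V ^+ n)) act3_V act3_U.
rewrite -(act3_V i 0%R) -act3M mulgV act1 add0r.
by congr (_, _, _); rewrite add0r.
Qed.

Lemma act3_K i (g : F2xZ) : K g -> exists d c,
  act (step3 i) s0 g.1 = (false, (3 * Posz p * d)%R, c).
Proof.
move: g; apply: generated_sub; last first.
  move=> _ [->|[n _ <-]]; last first.
    by exists 0%R, (6 * (loop_at i (3 * Posz n))%:Z)%R; rewrite act3_conjugate mulr0.
  by exists 1%R, 0%R; rewrite act3_V add0r mulr1.
split.
- by exists 0%R, 0%R; rewrite mulr0.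
- move=> g h [d [c gd]] [e [c' he]]; exists (e + d)%R, (c' + c)%R.
  rewrite act3M gd; have := act3_shift d c he.
  by rewrite !add0r => ->; congr (_, _, _); lia.
- move=> g [d [c gd]]; exists (- d)%R, (- c)%R.
  have : act (step3 i) (false, (3 * Posz p * d)%R, c) g^-1.1 = s0.
    by rewrite -gd -act3M mulgV.
  move=> /(act3_shift (- d)%R (- c)%R); rewrite subrr mulrN subrr => ->.
  by congr (_, _, _); lia.
Qed.

Lemma act3_additive i (g h : F2xZ) : K g -> K h ->
  (act (step3 i) s0 (g * h).1).1.2
    = ((act (step3 i) s0 g.1).1.2 + (act (step3 i) s0 h.1).1.2)%R
  /\ (act (step3 i) s0 (g * h).1).2
    = ((act (step3 i) s0 g.1).2 + (act (step3 i) s0 h.1).2)%R.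
Proof.
move=> /(act3_K i)[d [c gd]] /(act3_K i)[e [c' he]].
rewrite act3M gd he; have := act3_shift d c he.
by rewrite !add0r => -> /=; split; apply: addrC.
Qed.

(** The counters of the loops separate the conjugates of [U], on which the shift
    vanishes, and the shift detects [V ^+ p]. *)
Lemma K_rank : has_rank K (p + 1).
Proof.
pose gen (i : 'I_(p + 1)) : F2xZ := if (i < p)%N then V ^+ i * U * V ^- i else V ^+ p.
pose phi (i : 'I_(p + 1)) (g : F2xZ) : int :=
  let s := act (step3 i) s0 g.1 in if (i < p)%N then s.2 else s.1.2.
apply: (@has_rank_intro _ K _ (p + 1) gen phi erefl).
- pose s := V ^+ p :: [seq V ^+ i * U * V ^- i | i <- iota 0 p].
  have <- : size s = (p + 1)%N by rewrite /= size_map size_iota addn1.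
  apply: card_le_mem => _ [->|[i lt_ip <-]]; first by rewrite /= mem_head.
  by rewrite /= inE; apply/orP; right; apply/mapP; exists i => //; rewrite mem_iota.
- move=> i g h Kx Ky; have [e1 e2] := act3_additive i Kx Ky.
  by rewrite /phi; case: ifP.
- move=> i; rewrite /gen; case: ifP => [lt_ip|_]; apply: mem_generated; last by left.
  by right; exists i.
- move=> i j lt_ji; have lt_jp : (j < p)%N by have := ltn_ord i; lia.
  rewrite /phi /gen lt_jp; case: ifP => [lt_ip|_]; last by rewrite act3_V.
  rewrite act3_conjugate /= (_ : loop_at j _ = false) //.
  apply/negP => /dvdzP[q e]; have : (Posz i - Posz j = q * Posz p)%R by lia.
  by case: q {e} => [[|q]|q]; nia.
- move=> i; rewrite /phi /gen; case: ifP => lt_ip; rewrite lt_ip.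
    by rewrite act3_conjugate /= /loop_at subrr dvdz0.
  by rewrite act3_V /=; lia.
Qed.

End FixedIndex.
End Example.

Lemma injective_has_rank (G G' : groupType) (f : {multiplicative G -> G'}) K n :
  injective f -> is_subgroup K -> has_rank K n -> has_rank (f @` K) n.
Proof.
move=> finj Kg [[S [SK Sn]] lower]; split.
  exists (f @` S); split; first by rewrite -image_generated SK.
  apply: card_eq_trans Sn; apply: inj_card_eq => g h _ _; exact: finj.
move=> S' S'K; pose S1 := f @^-1` S'.
have fS1 : f @` S1 = S'.
  apply/seteqP; split=> [_ [g Sg <-]//|s Ss].
  have /mem_generated := Ss; rewrite S'K => -[g Kx gs].
  by exists g => //; rewrite /S1 /= gs.
have S1K : generated S1 = K.
  apply/seteqP; split=> g gK.
    have : (f @` K) (f g) by rewrite -S'K -fS1 -image_generated; exists g.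
    by move=> [h Kh /finj<-].
  have : (f @` generated S1) (f g) by rewrite image_generated fS1 S'K; exists g.
  by move=> [h Kh /finj<-].
apply: card_le_trans (lower _ S1K) _; rewrite -fS1.
by apply: (@card_le_inj _ _ _ _ f) => [g Sg|g h _ _ /finj //]; exists g.
Qed.

Theorem mainTheorem9 :
  (forall p : nat, (1 <= p)%N ->
     let H1 := generated [set x ^+ 3 * t ^+ 6; y * x; t ^+ (6 * p)%N] in
     let H2 := generated [set x ^+ 2 * t ^+ 4; y * x * y^-1] in
     [/\ has_rank H1 3, has_rank H2 2 & has_rank (H1 `&` H2) (p + 1)%N])
  /\
  (forall (G : groupType) (f : {multiplicative F2xZ -> G}), injective f ->
     ~ exists B : nat -> nat -> nat,
         forall (K1 K2 : set G) (a b r : nat),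
           is_subgroup K1 -> is_subgroup K2 ->
           has_rank K1 a -> has_rank K2 b -> has_rank (K1 `&` K2) r ->
           (r <= B a b)%N)
  /\
  (forall a b : nat, (a + b < 5)%N ->
     exists N : nat,
       forall (K1 K2 : set F2xZ) (r : nat),
         is_subgroup K1 -> is_subgroup K2 ->
         has_rank K1 a -> has_rank K2 b -> has_rank (K1 `&` K2) r ->
         (r <= N)%N).
Proof.
have example p : (1 <= p)%N ->
    let H1 := generated [set x ^+ 3 * t ^+ 6; y * x; t ^+ (6 * p)%N] in
    let H2 := generated [set x ^+ 2 * t ^+ 4; y * x * y^-1] in
    [/\ has_rank H1 3, has_rank H2 2 & has_rank (H1 `&` H2) (p + 1)%N].
  move=> p_gt0; split; [exact: H1_rank|exact: H2_rank|].
  by rewrite intersectionE //; apply: K_rank.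
split=> //; split; last exact: bounded_rank_sum.
move=> G f finj [B bound].
have [r1 r2 r12] := example (B 3 2).+1 isT.
set H1 := generated _ in r1 r12; set H2 := generated _ in r2 r12.
have H1g : is_subgroup H1 by apply: generated_subgroup.
have H2g : is_subgroup H2 by apply: generated_subgroup.
have fI : f @` (H1 `&` H2) = f @` H1 `&` f @` H2.
  apply/seteqP; split=> [_ [g [H1x H2x] <-]|_ [[g H1x <-] [h H2x /finj hg]]].
    by split; exists g.
  by exists g => //; split=> //; rewrite -hg.
have := bound _ _ _ _ _ (image_subgroup f H1g) (image_subgroup f H2g)
  (injective_has_rank finj H1g r1) (injective_has_rank finj H2g r2).
rewrite -fI => /(_ _ (injective_has_rank finj (subgroupI H1g H2g) r12)).
by lia.
Qed.
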